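(* For every $x\in(-\frac18,1)$ with $x\notin\{1-\frac{3}{2N}: N\in\mathbb{N},\,N\ge2\}$ we have $s(x)>r(x)$, and there exists a bivariate copula $C_x$ with $\phi(C_x)=x$ and $\rho(C_x)=s(x)$.
   Context: $\lambda,\lambda_2$ denote one- and two-dimensional Lebesgue measure. For a bivariate copula $C$, Spearman's rho and Spearman's footrule are $$\rho(C)=12\int_{[0,1]^2}C\,d\lambda_2-3,\qquad \phi(C)=6\int_{[0,1]}C(u,u)\,d\lambda(u)-2 .$$ The function $r:[-\frac12,1]\to[-1,1]$ is $$r(x)=\begin{cases}2x+\frac12-\frac{\sqrt3}{9}(1+2x)^{3/2}, & x\in[-\frac12,-\frac18],\\ \frac43x+\frac7{24}, & x\in[-\frac18,\frac14],\\ \frac{2n+1}{n^2+n}x+\frac{2n^2-2n+1}{2n^2+2n}, & x\in[1-\frac{3}{2n},1-\frac{3}{2(n+1)}],\ n\in\mathbb{N},\ n\ge2,\\ 1,& x=1.\end{cases}$$ For even $n$, $S_n^\ast$ is the shuffle $S_{\pi^\ast}$ of the involution $\pi^\ast$ of $\{1,\dots,n\}$ with $\pi^\ast(i)=i-1$ for even $i$ and $\pi^\ast(i)=i+1$ for odd $i$; here $S_\pi(x)=x-\frac{i-\pi(i)}{n}$ for $x\in(\frac{i-1}{n},\frac in)$. It is identified with its copula $C(u,v)=\lambda(\{x\in[0,u]:S_{\pi^\ast}(x)\le v\})$, so that $\phi(S_n^\ast)$ and $\rho(S_n^\ast)$ are defined. For $a\in[\frac14,\frac12]$ let $\delta_a^\uparrow(x)=0$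 for $x\in[0,a]$, $\delta_a^\uparrow(x)=x-a$ for $x\in[a,1-a]$, $\delta_a^\uparrow(x)=2x-1$ for $x\in[1-a,1]$, and let $E_a$ be the copula $$E_a(u,v)=\min\Bigl\{u,v,\tfrac{\delta_a^\uparrow(u)+\delta_a^\uparrow(v)}2\Bigr\}.$$ For $N\in\mathbb{N}$, $O_a^N$ is the ordinal sum of $N$ copies of $E_a$ with respect to the intervals $(\frac{k-1}N,\frac kN)$, $k=1,\dots,N$, i.e. $O_a^N(u,v)=\frac{k-1}{N}+\frac1N E_a(Nu-k+1,Nv-k+1)$ if $(u,v)\in(\frac{k-1}N,\frac kN)^2$ for some $k$, and $O_a^N(u,v)=\min\{u,v\}$ elsewhere. Put $a_N:=\frac{N}{2N+2}$. The function $s:[-\frac12,1]\to[-1,1]$ is $$s(x)=\begin{cases}2x+\frac12-\frac{\sqrt3}{9}(1+2x)^{3/2}, & x\in[-\frac12,-\frac18],\\[3pt] x+\frac38-\frac{\sqrt6}{36}(1-4x)^{3/2}, & x\in[-\frac18,\frac14],\\[3pt] \frac{\rho(O_{a_N}^N)-\rho(S_{2N}^\ast)}{\phi(O_{a_N}^N)-\phi(S_{2N}^\ast)}\bigl(x-\phi(S_{2N}^\ast)\bigr)+\rho(S_{2N}^\ast), & x\in[\phi(S_{2N}^\ast),\phi(O_{a_N}^N)],\ N\ge2,\\[3pt] \frac{\rho(S_{2N+2}^\ast)-\rho(O_{a_N}^N)}{\phi(S_{2N+2}^\ast)-\phi(O_{a_N}^N)}\bigl(x-\phi(O_{a_N}^N)\bigr)+\rho(O_{a_N}^N),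 & x\in[\phi(O_{a_N}^N),\phi(S_{2N+2}^\ast)],\ N\ge2,\\[3pt] 1,& x=1.\end{cases}$$ *)

(* Defs.v *)
From HB Require Import structures.
From mathcomp Require Import all_boot all_order all_algebra.
From mathcomp Require Import all_classical all_reals all_analysis.
Set Implicit Arguments.
Unset Strict Implicit.
Unset Printing Implicit Defensive.
Import Order.TTheory GRing.Theory Num.Theory.
Import numFieldNormedType.Exports.
Local Open Scope classical_set_scope.
Local Open Scope ring_scope.

(* Functions on [0,1]^2, [0,1] or [-1/2,1] are represented by total functions
   on the reals, whose values outside the intended domain play no role. *)

Record is_copula (R : realType) (C : R -> R -> R) : Prop := IsCopula {
  copula_0l : forall v, 0 <= v <= 1 -> C 0 v = 0 ;
  copula_0r : forall u, 0 <= u <= 1 -> C u 0 = 0 ;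
  copula_1l : forall v, 0 <= v <= 1 -> C 1 v = v ;
  copula_1r : forall u, 0 <= u <= 1 -> C u 1 = u ;
  copula_2increasing : forall u1 u2 v1 v2,
    0 <= u1 -> u1 <= u2 -> u2 <= 1 -> 0 <= v1 -> v1 <= v2 -> v2 <= 1 ->
    0 <= C u2 v2 - C u2 v1 - C u1 v2 + C u1 v1 }.

Definition lebesgue2 (R : realType) :=
  ((@lebesgue_measure R) \x (@lebesgue_measure R))%E.

Definition rho (R : realType) (C : R -> R -> R) : R :=
  12 * Rintegral (@lebesgue2 R) (`[0, 1] `*` `[0, 1]) (fun p => C p.1 p.2) - 3.

Definition phi (R : realType) (C : R -> R -> R) : R :=
  6 * Rintegral (@lebesgue_measure R) `[0, 1] (fun u => C u u) - 2.

(* At most one summand is nonzero: on the open interval ((i-1)/n, i/n) the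
   value is x - (i - f i)/n.  The finitely many interval endpoints, where the
   shuffle is left unspecified, are sent to themselves. *)
Definition shuffle (R : realType) (n : nat) (f : nat -> nat) (x : R) : R :=
  x - \sum_(1 <= i < n.+1)
        (if i.-1%:R / n%:R < x < i%:R / n%:R
         then (i%:R - (f i)%:R) / n%:R else 0).

Definition shuffle_copula (R : realType) (n : nat) (f : nat -> nat)
    (u v : R) : R :=
  fine (@lebesgue_measure R [set x | 0 <= x <= u /\ shuffle n f x <= v]).

(* Acts on {1, ..., n}, n even. *)
Definition pi_star (i : nat) : nat := if odd i then i.+1 else i.-1.

Definition S_star (R : realType) (n : nat) : R -> R -> R :=
  shuffle_copula n pi_star.

Definition delta_up (R : realType) (a x : R) : R :=
  if x <= a then 0 else if x <= 1 - a then x - a else 2 * x - 1.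

Definition E_cop (R : realType) (a u v : R) : R :=
  Num.min (Num.min u v) ((delta_up a u + delta_up a v) / 2).

(* The intervals are indexed from 0: k stands for (k/N, (k+1)/N).  They are
   disjoint, so at most one k can be picked. *)
Definition O_cop (R : realType) (a : R) (N : nat) (u v : R) : R :=
  if [pick k : 'I_N | (k%:R / N%:R < u < k.+1%:R / N%:R)
                      && (k%:R / N%:R < v < k.+1%:R / N%:R)] is Some k
  then k%:R / N%:R + N%:R^-1 * E_cop a (N%:R * u - k%:R) (N%:R * v - k%:R)
  else Num.min u v.

Definition a_seq (R : realType) (N : nat) : R := N%:R / (2 * N%:R + 2).

(* O_{a_N}^N *)
Definition O_star (R : realType) (N : nat) : R -> R -> R := O_cop (a_seq R N) N.

(* r and s are given by formulas on closed intervals covering [-1/2, 1];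
   adjacent intervals share an endpoint, at which the two formulas agree.
   The graphs collect the pieces and the functions read off the value. *)
Inductive r_graph (R : realType) (x : R) : R -> Prop :=
| r_piece1 : - (1 / 2) <= x <= - (1 / 8) ->
    r_graph x (2 * x + 1 / 2 - Num.sqrt 3 / 9 * (1 + 2 * x) `^ (3 / 2))
| r_piece2 : - (1 / 8) <= x <= 1 / 4 ->
    r_graph x (4 / 3 * x + 7 / 24)
| r_piece3 (n : nat) : (2 <= n)%N ->
    1 - 3 / (2 * n%:R) <= x <= 1 - 3 / (2 * (n%:R + 1)) ->
    r_graph x ((2 * n%:R + 1) / (n%:R ^+ 2 + n%:R) * x
               + (2 * n%:R ^+ 2 - 2 * n%:R + 1) / (2 * n%:R ^+ 2 + 2 * n%:R))
| r_piece4 : x = 1 -> r_graph x 1.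

Definition r_fun (R : realType) (x : R) : R := xget 0 [set y | r_graph x y].

Inductive s_graph (R : realType) (x : R) : R -> Prop :=
| s_piece1 : - (1 / 2) <= x <= - (1 / 8) ->
    s_graph x (2 * x + 1 / 2 - Num.sqrt 3 / 9 * (1 + 2 * x) `^ (3 / 2))
| s_piece2 : - (1 / 8) <= x <= 1 / 4 ->
    s_graph x (x + 3 / 8 - Num.sqrt 6 / 36 * (1 - 4 * x) `^ (3 / 2))
| s_piece3 (N : nat) : (2 <= N)%N ->
    phi (S_star (2 * N)%N) <= x <= phi (O_star N) ->
    s_graph x ((rho (O_star N) - rho (S_star (2 * N)%N))
               / (phi (O_star N) - phi (S_star (2 * N)%N))
               * (x - phi (S_star (2 * N)%N)) + rho (S_star (2 * N)%N))
| s_piece4 (N : nat) : (2 <= N)%N ->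
    phi (O_star N) <= x <= phi (S_star (2 * N + 2)%N) ->
    s_graph x ((rho (S_star (2 * N + 2)%N) - rho (O_star N))
               / (phi (S_star (2 * N + 2)%N) - phi (O_star N))
               * (x - phi (O_star N)) + rho (O_star N))
| s_piece5 : x = 1 -> s_graph x 1.

Definition s_fun (R : realType) (x : R) : R := xget 0 [set y | s_graph x y].

(* Main.v *)
Require Import Defs.
From HB Require Import structures.
From mathcomp Require Import all_boot all_order all_algebra.
From mathcomp Require Import all_classical all_reals all_analysis.
From mathcomp Require Import measurable_realfun ring lra.
Set Implicit Arguments.
Unset Strict Implicit.
Unset Printing Implicit Defensive.
Import Order.TTheory GRing.Theory Num.Theory.
Import numFieldNormedType.Exports.
Local Open Scope classical_set_scope.
Local Open Scope ring_scope.

(** On the law of a pair (X, Y) with copula C, the footrule and rho are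
      phi(C) = 1 - 3 E|X - Y|   and   rho(C) = 1 - 6 E(X - Y)^2.
    Both are affine in C and copulas form a convex set, so that a chord between two
    points attained by copulas consists of attained points ([attained_chord]).

    On [1/4, 1] the function r is the polygon through the points of the shuffles
    S_(2N), located at x = 1 - 3/(2N), and s is a polygon with one more vertex, the
    point of the ordinal sum O_N, between any two consecutive ones. The new vertex
    lies above the edge of r by exactly 1 / (2 N^2 (N + 1)^3)
    ([O_star_above_r_line]); hence s > r except at the shuffles, which are the
    excluded points ([attained_upper_branch]).

    On (-1/8, 1/4) the values of s are attained by a one-parameter family [bridge]
    leading from E_(1/4) to S_4, for which |X - Y| is 1/4 plus a variable which
    is uniform on [0, c] with probability 4c and zero otherwise
    ([attained_lower_branch]).

    What has to be computed are phi and rho of these copulas. Their laws are all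
    finite sums of uniform masses on increasing segments. Such a mass has the
    distribution function [seg], whose integrals over the square and over the
    diagonal are polynomials in its parameters ([Rintegral_seg],
    [seg_diag_below]); summation over the segments gives the values
    ([moments_bridge], [moments_osum]). The copula E_a, given by a formula, and the
    shuffle, given by the measure of a set, are brought to this form by [E_copE] and
    [shuffle_copulaE]. The shuffle S_(2N) is the ordinal sum of N copies of
    E_(1/2) ([S_starE]), so that one computation covers both kinds of vertices. *)

(** * Lattice operations on the real line *)

Ltac minmax_free t :=
  lazymatch t with
  | context [Order.min _ _] => fail
  | context [Order.max _ _] => fail
  | _ => idtac
  end.

(** Innermost minima and maxima first: a comparison is decided only between
    terms free of min and max, which [lra] can then use. *)
Ltac case_minmax := repeat match goal with
  | |- context [Order.min ?a ?b] =>
      minmax_free a; minmax_free b; case: (leP a b) => ? /=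
  | |- context [Order.max ?a ?b] =>
      minmax_free a; minmax_free b; case: (leP a b) => ? /=
  end.

Section clamping.
Variable R : realType.

(** The length of the part of [0, w] lying below t. *)
Definition clamp (w t : R) : R := Num.max 0 (Num.min w t).

Lemma clampP (w t : R) : 0 <= w ->
  [\/ t <= 0 /\ clamp w t = 0, 0 <= t <= w /\ clamp w t = t | w <= t /\ clamp w t = w].
Proof.
move=> w0; rewrite /clamp; have [t0|/ltW t0] := leP t 0.
  by apply: Or31; split=> //; case_minmax; lra.
have [tw|/ltW tw] := leP t w.
  by apply: Or32; split; [rewrite t0|case_minmax; lra].
by apply: Or33; split=> //; case_minmax; lra.
Qed.

Lemma eq_clamp (w s t : R) : 0 <= w ->
  [\/ s = t, s <= 0 /\ t <= 0 | w <= s /\ w <= t] -> clamp w s = clamp w t.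
Proof.
move=> w0 [->//|[s0 t0]|[ws wt]]; rewrite /clamp.
  by rewrite !max_l// ge_min ?s0 ?t0 orbT.
by rewrite !min_l.
Qed.

Lemma le_clamp (w s t : R) : s <= t -> clamp w s <= clamp w t.
Proof. by rewrite /clamp; case_minmax; lra. Qed.

(** Stacking [0, w] and [w, w + w'] gives [0, w + w']. *)
Lemma clampD (w w' t : R) : 0 <= w -> 0 <= w' ->
  clamp w t + clamp w' (t - w) = clamp (w + w') t.
Proof.
move=> w0 w0'.
have [//|[h1 ->]|[h1 ->]|[h1 ->]] := @clampP w t;
have [//|[h2 ->]|[h2 ->]|[h2 ->]] := @clampP w' (t - w); try lra;
have [|[h3 ->]|[h3 ->]|[h3 ->]] := @clampP (w + w') t; lra.
Qed.

Lemma clampM (c w t : R) : 0 <= c -> c * clamp w t = clamp (c * w) (c * t).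
Proof. by move=> c0; rewrite /clamp maxr_pMr// minr_pMr// mulr0. Qed.

Lemma clamp_chain (c1 c2 c3 x : R) : 0 <= c1 -> c1 <= c2 -> c2 <= c3 ->
  0 <= x -> x <= c3 ->
  x = clamp c1 x + clamp (c2 - c1) (x - c1) + clamp (c3 - c2) (x - c2).
Proof.
move=> c10 c12 c23 x0 x3.
rewrite clampD; [|lra|lra]; rewrite (addrC c1) subrK clampD; [|lra|lra].
by rewrite addrC subrK /clamp; case_minmax; lra.
Qed.

Lemma clamp_min (w s t : R) : clamp w (Num.min s t) = Num.min (clamp w s) (clamp w t).
Proof.
have [st|/ltW ts] := leP s t; first by rewrite min_l// le_clamp.
by rewrite min_r// le_clamp.
Qed.

Lemma clamp1E (t : R) : 0 <= t <= 1 -> clamp 1 t = t.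
Proof. by have [|[h ->]|[h ->]|[h ->]] := @clampP 1 t; lra. Qed.

Lemma sum_clamp n (t : R) : 0 <= t -> \sum_(i < n) clamp 1 (t - i%:R) = Num.min t n%:R.
Proof.
move=> t0; elim: n => [|n IH]; first by rewrite big_ord0 min_r.
rewrite big_ord_recr/= IH -natr1.
have [|[h ->]|[h ->]|[h ->]] := @clampP 1 (t - n%:R); first lra;
  by case_minmax; lra.
Qed.

Lemma clamp1_itv (t : R) : 0 <= clamp 1 t <= 1.
Proof. by have [|[h ->]|[h ->]|[h ->]] := @clampP 1 t; lra. Qed.

(** Cut [0, t] along N blocks of length 1/N and rescale each block to [0, 1]: the
    total length is N t. This gives ordinal sums their uniform margins. *)
Lemma mean_clamp N (t : R) : (0 < N)%N -> 0 <= t <= 1 ->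
  \sum_(i < N) clamp 1 (N%:R * t - i%:R) = N%:R * t.
Proof.
move=> N0 /andP[t0 t1]; have NR : 0 < N%:R :> R by rewrite ltr0n.
rewrite sum_clamp; last by rewrite mulr_ge0// ltW.
by rewrite min_l// ler_piMr// ltW.
Qed.

End clamping.

(** * Integration on the unit interval and the unit square *)

Section integration.
Variable R : realType.
Local Notation mu := (@lebesgue_measure R).
Local Notation mu2 := (@lebesgue2 R).
Local Notation I01 := (`[0, 1]%classic : set R).

Lemma bounded_integrable d (T : measurableType d)
    (m : {measure set T -> \bar R}) (D : set T) (M : R) (f : T -> R) :
  measurable D -> (m D < +oo)%E -> measurable_fun D f ->
  (forall x, D x -> 0 <= f x <= M) -> m.-integrable D (EFin \o f).
Proof.
move=> mD fD mf fM; apply: measurable_bounded_integrable => //.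
exists M; split; first exact: num_real.
move=> N MN x Dx /=; have /andP[f0 fm] := fM _ Dx.
by rewrite ger0_norm// (le_trans fm)// ltW.
Qed.

Lemma lebesgue_itv01 : mu I01 = 1%:E.
Proof. by rewrite lebesgue_measure_itv /= lte_fin ltr01 sube0. Qed.

Lemma lebesgue2_square : mu2 (I01 `*` I01) = 1%:E.
Proof.
rewrite /lebesgue2 product_measure1E//.
by rewrite [X in (X * _)%E](lebesgue_itv01) [X in (_ * X)%E](lebesgue_itv01) mule1.
Qed.

(** The one integral computed from a primitive; all others reduce to it. *)
Lemma Rintegral_itv_shift_exp (p h : R) (n : nat) : 0 <= h ->
  Rintegral mu `[p, p + h] (fun x => (x - p) ^+ n) = h ^+ n.+1 / n.+1%:R.
Proof.
rewrite le_eqVlt => /predU1P[<-|h0].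
  by rewrite addr0 set_itv1 Rintegral_set1 expr0n mul0r.
pose F (x : R) := n.+1%:R^-1 * (x - p) ^+ n.+1.
have dX m x : is_derive x (1 : R) (fun x => (x - p) ^+ m) (m%:R * (x - p) ^+ m.-1).
  have -> : (fun x => (x - p) ^+ m) = (id - cst p) ^+ m.
    by apply/funext => y; rewrite !fctE.
  by apply: is_derive_eq; rewrite !fctE subr0 scaler1.
have dF x : is_derive x (1 : R) F ((x - p) ^+ n).
  have -> : F = n.+1%:R^-1 *: (fun x => (x - p) ^+ n.+1) by [].
  apply: is_derive_eq.
  by rewrite -[LHS]/(_ * _) mulrA mulVf ?mul1r// pnatr_eq0.
have is_derive_cont (f df : R -> R) : (forall x, is_derive x (1 : R) f (df x)) -> continuous f.
  move=> dfE x; apply: differentiable_continuous; apply/derivable1_diffP.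
  by apply: (ex_derive (is_derive := dfE x)).
have cF : continuous F by apply: is_derive_cont dF.
rewrite /Rintegral (@continuous_FTC2 R _ F).
- by rewrite /F/= addrAC !subrr add0r expr0n/= mulr0 subr0 mulrC.
- by rewrite ltrDl.
- by apply: continuous_subspaceT; exact: is_derive_cont (dX n).
- split.
  + by move=> x _; apply: (ex_derive (is_derive := dF x)).
  + exact/cvg_at_right_filter/cF.
  + exact/cvg_at_left_filter/cF.
- by move=> x _; rewrite derive1E; apply: (derive_val (is_derive := dF x)).
Qed.

(** Tonelli's theorem on the unit square, for bounded integrands. *)
Lemma Rintegral_square (f : R * R -> R) (g : R -> R) :
  measurable_fun setT f -> (forall z, 0 <= f z <= 1) ->
  (forall u, 0 <= u <= 1 -> Rintegral mu I01 (fun v => f (u, v)) = g u) ->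
  Rintegral mu2 (I01 `*` I01) f = Rintegral mu I01 g.
Proof.
move=> mf f01 fg; rewrite /Rintegral; congr fine.
have mI2 : measurable (I01 `*` I01) by apply: measurableX.
rewrite integral_mkcond fubini_tonelli1; first last.
- move=> z; rewrite patchE; case: ifP => // _.
  by rewrite lee_fin; case/andP: (f01 z).
- by apply/(measurable_restrictT _ mI2)/measurable_EFinP; exact: measurable_funTS.
rewrite [RHS]integral_mkcond; apply: eq_integral => u _.
rewrite /fubini_F [RHS]patchE; case: ifPn => uI.
  rewrite -fg; last by move: uI; rewrite inE/= in_itv.
  rewrite /Rintegral fineK; last first.
    apply: integrable_fin_num => //.
    apply: (@bounded_integrable _ _ _ _ 1) => //.
    + by rewrite [X in (X < _)%E]lebesgue_itv01 ltry.
    + apply: measurable_funTS; apply: (measurableT_comp mf); exact: pair1_measurable.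
  rewrite [RHS]integral_mkcond; apply: eq_integral => v _.
  by rewrite !patchE in_setX uI.
by rewrite integral0_eq// => v _; rewrite patchE in_setX (negbTE uI).
Qed.

End integration.

(** * Masses on segments *)

Section segments.
Variable R : realType.
Local Notation mu := (@lebesgue_measure R).
Local Notation mu2 := (@lebesgue2 R).
Local Notation I01 := (`[0, 1]%classic : set R).

(** The distribution function of a mass w spread with density 1/k on
    [p, p + k w]. Taking the inverse density k as parameter instead of the length
    of the interval allows w = 0 without dividing by zero. *)
Definition ramp (w p k u : R) : R := clamp w ((u - p) / k).

Lemma measurable_ramp w p k (D : set R) : measurable_fun D (ramp w p k).
Proof.
apply: measurable_funTS; apply: measurable_maxr => //.
apply: measurable_minr => //.
apply: measurable_funM => //; exact: measurable_funB.
Qed.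

Lemma ramp_ge0 w p k u : 0 <= ramp w p k u.
Proof. by rewrite /ramp /clamp le_max lexx. Qed.

Lemma ramp_le w p k u : 0 <= w -> ramp w p k u <= w.
Proof. by move=> w0; rewrite /ramp /clamp ge_max w0 ge_min lexx. Qed.

(** The ramp is 0 before p, linear on [p, p + k w] and w afterwards, whence the
    two terms. *)
Lemma Rintegral_ramp_exp (w p k : R) (n : nat) :
  0 <= w -> 0 < k -> 0 <= p -> p + k * w <= 1 ->
  Rintegral mu I01 (fun u => ramp w p k u ^+ n.+1) =
  k * w ^+ n.+2 / n.+2%:R + w ^+ n.+1 * (1 - p - k * w).
Proof.
move=> w0 k0 p0 pkw.
have kw0 : 0 <= k * w by rewrite mulr_ge0// ltW.
pose f u := ramp w p k u ^+ n.+1.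
have fi (D : set R) : measurable D -> D `<=` I01 -> mu.-integrable D (EFin \o f).
  move=> mD DI; apply: (@bounded_integrable _ _ _ _ _ (w ^+ n.+1)) => //.
  - apply: (@le_lt_trans _ _ (mu I01)); last by rewrite lebesgue_itv01 ltry.
    by apply: le_measure; rewrite ?inE.
  - apply: measurable_funX => //.
    exact: measurable_ramp.
  - by move=> x _; rewrite exprn_ge0 ?ramp_ge0// lerXn2r// ?nnegrE ?ramp_ge0// ramp_le.
have -> : I01 = `[0, p[ `|` (`[p, p + k * w] `|` `]p + k * w, 1]).
  apply/seteqP; split=> x /=; rewrite !in_itv/=.
    move=> /andP[x0 x1]; have [xp|px] := ltP x p; first by left; rewrite x0.
    right; have [xp|pkx] := leP x (p + k * w); first by left; rewrite ?px.
    by right; rewrite ?x1.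
  by move=> [/andP[]|[/andP[]|/andP[]]] *; apply/andP; split; lra.
rewrite -/f.
rewrite Rintegral_setU//; first last.
- apply/disj_setPRL => x /=; rewrite !in_itv/= => -[/andP[]|/andP[]] *; apply/negP; lra.
- apply: fi; first by do 2 apply: measurableU => //.
  move=> x /=; rewrite !in_itv/= => -[/andP[]|[/andP[]|/andP[]]] *; apply/andP; split; lra.
- by apply: measurableU.
rewrite Rintegral_setU//; first last.
- apply/disj_setPRL => x /=; rewrite !in_itv/= => /andP[] *; apply/negP; lra.
- apply: fi; first by apply: measurableU => //.
  by move=> x /=; rewrite !in_itv/= => -[/andP[]|/andP[]] *; apply/andP; split; lra.
have -> : Rintegral mu `[0, p[ f = 0.
  rewrite (@eq_Rintegral _ _ _ _ _ (cst 0)).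
    by rewrite Rintegral_cst// mul0r.
  move=> x; rewrite inE/= in_itv/= => /andP[x0 xp].
  rewrite /f /ramp /clamp max_l ?expr0n// ge_min; apply/orP; right.
  by rewrite pmulr_lle0 ?invr_gt0//; lra.
have -> : Rintegral mu `]p + k * w, 1] f = w ^+ n.+1 * (1 - p - k * w).
  rewrite (@eq_Rintegral _ _ _ _ _ (cst (w ^+ n.+1))).
    rewrite Rintegral_cst// [X in fine X]lebesgue_measure_itv /= lte_fin.
    case: ltP => //= h; first by congr (_ * _); lra.
    by congr (_ * _); lra.
  move=> x; rewrite inE/= in_itv/= => /andP[x0 xp].
  rewrite /f /ramp /clamp min_l ?max_r//.
  by rewrite ler_pdivlMr// mulrC; lra.
have -> : Rintegral mu `[p, p + k * w] f =
    Rintegral mu `[p, p + k * w] (fun x => k^-1 ^+ n.+1 * (x - p) ^+ n.+1).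
  apply: eq_Rintegral => x; rewrite inE/= in_itv/= => /andP[x0 xp].
  rewrite /f /ramp /clamp min_r ?max_r.
  - by rewrite mulrC exprMn.
  - by rewrite divr_ge0//; lra.
  - by rewrite ler_pdivrMr// mulrC; lra.
rewrite RintegralZl//; last first.
  apply: (@bounded_integrable _ _ _ _ _ ((k * w) ^+ n.+1)) => //.
  - by rewrite /= lebesgue_measure_itv /= ; case: ifP => // _; rewrite ltry.
  - apply: measurable_funX => //.
    exact: measurable_funB.
  - move=> x; rewrite /= in_itv/= => /andP[x0 xp].
    have ? : 0 <= x - p by lra.
    rewrite exprn_ge0//= lerXn2r ?nnegrE//; lra.
rewrite Rintegral_itv_shift_exp// add0r; congr (_ + _).
rewrite mulrA; congr (_ / _).
rewrite exprMn mulrA; congr (_ * _).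
by rewrite [k ^+ _]exprS mulrCA -exprMn mulVf ?gt_eqF// expr1n mulr1.
Qed.

Lemma Rintegral_ramp (w p k : R) :
  0 <= w -> 0 < k -> 0 <= p -> p + k * w <= 1 ->
  Rintegral mu I01 (ramp w p k) = w * (1 - p) - k * w ^+ 2 / 2.
Proof.
move=> w0 k0 p0 h.
have -> : ramp w p k = (fun u => ramp w p k u ^+ 1) by [].
by rewrite Rintegral_ramp_exp// expr1; field.
Qed.

(** The distribution function of a mass w spread uniformly on the segment from
    (p, q) to (p + k w, q + l w): since the segment is increasing, the part of it
    in a lower-left quadrant is the smaller of the parts cut by the two sides. *)
Definition seg (w p k q l u v : R) : R := Num.min (ramp w p k u) (ramp w q l v).

Lemma measurable_seg w p k q l (D : set (R * R)) :
  measurable_fun D (fun z => seg w p k q l z.1 z.2).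
Proof.
apply: measurable_funTS; apply: measurable_minr.
- by apply: measurableT_comp; first exact: measurable_ramp.
- by apply: measurableT_comp; first exact: measurable_ramp.
Qed.

(** For fixed u, a section of [seg] in v is again a ramp, of the same slope; this
    is what makes the iterated integral elementary. *)
Lemma min_ramp A w q l v : 0 <= A -> A <= w ->
  Num.min A (ramp w q l v) = ramp A q l v.
Proof.
move=> A0 Aw; rewrite /ramp /clamp.
by set t := _ / _; case_minmax; lra.
Qed.

(** In probabilistic terms the value is w E((1 - X)(1 - Y)) for (X, Y) uniform on
    the segment. The inner integral is a quadratic polynomial in the ramp in u. *)
Lemma Rintegral_seg w p k q l :
  0 <= w <= 1 -> 0 < k -> 0 < l -> 0 <= p -> p + k * w <= 1 ->
  0 <= q -> q + l * w <= 1 ->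
  Rintegral mu2 (I01 `*` I01) (fun z => seg w p k q l z.1 z.2) =
  w * ((1 - p) * (1 - q) - (1 - p) * l * w / 2 - (1 - q) * k * w / 2
       + k * l * w ^+ 2 / 3).
Proof.
move=> /andP[w0 w1] k0 l0 p0 pw q0 qw.
rewrite (@Rintegral_square _ _ (fun u => (1 - q) * ramp w p k u ^+ 1 +
   (- (l / 2)) * ramp w p k u ^+ 2)); first last.
- move=> u _; rewrite expr1 /seg.
  have r0 := ramp_ge0 w p k u; have rw := @ramp_le w p k u w0.
  under eq_Rintegral do rewrite min_ramp//=.
  rewrite Rintegral_ramp//; first by field.
  by rewrite (le_trans _ qw)// lerD2l ler_pM2l.
- move=> z; rewrite /seg le_min !ramp_ge0/= ge_min.
  by rewrite (le_trans (@ramp_le _ _ _ _ w0)).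
- exact: measurable_seg.
have ri n (c : R) : mu.-integrable I01 (EFin \o (fun u => c * ramp w p k u ^+ n)).
  have := @integrableZl _ _ _ mu I01 (measurable_itv _) c (fun u => (ramp w p k u ^+ n)%:E).
  apply => //.
  apply: (@bounded_integrable _ _ _ _ _ (w ^+ n)) => //.
  - by rewrite [X in (X < _)%E]lebesgue_itv01 ltry.
  - by apply: measurable_funX => //; exact: measurable_ramp.
  - by move=> x _; rewrite exprn_ge0 ?ramp_ge0// lerXn2r// ?nnegrE ?ramp_ge0// ramp_le.
have ri1 n : mu.-integrable I01 (EFin \o (fun u => ramp w p k u ^+ n)).
  have -> : (fun u => ramp w p k u ^+ n) = (fun u => 1 * ramp w p k u ^+ n).
    by apply/funext => u; rewrite mul1r.
  exact: ri.
rewrite RintegralD// !RintegralZl// !Rintegral_ramp_exp//.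
by field.
Qed.

(** If the segment lies in the region v <= u, then its points with abscissa at most
    u also have ordinate at most u. *)
Lemma seg_diag_below w p k q l u : 0 <= w -> 0 < k -> 0 < l ->
  q <= p -> q + l * w <= p + k * w -> seg w p k q l u u = ramp w p k u.
Proof.
move=> w0 k0 l0 qp h; rewrite /seg min_l// /ramp /clamp.
set t := _ / k; set t' := _ / l.
have ut : u = p + k * t by rewrite /t mulrC divfK ?gt_eqF// addrC subrK.
have ut' : u = q + l * t' by rewrite /t' mulrC divfK ?gt_eqF// addrC subrK.
clearbody t t'.
have lt' : l * t' = p - q + k * t by lra.
have H : 0 <= t -> t <= w -> t <= t'.
  move=> t0 tw; rewrite -(ler_pM2l l0) lt'.
  by have [lk|kl] := leP l k; nra.
have Hw : w <= t -> w <= t'.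
  by move=> wt; rewrite -(ler_pM2l l0) lt'; have := ler_wpM2l (ltW k0) wt; lra.
have [tw|/ltW/Hw ?] := leP t w; last by case_minmax; lra.
have [t0|t0] := leP 0 t; first by have := H t0 tw; case_minmax; lra.
by case_minmax; lra.
Qed.

End segments.

(** * Moments and margins of sums of segments *)

Section copulas.
Variable R : realType.
Local Notation mu := (@lebesgue_measure R).
Local Notation mu2 := (@lebesgue2 R).
Local Notation I01 := (`[0, 1]%classic : set R).

(** Reflection in the diagonal is built in: all the copulas considered are symmetric
    sums of such pairs, so that only segments with v <= u have to be listed. *)
Definition twin (w p k q l u v : R) : R :=
  seg w p k q l u v + seg w q l p k u v.

(** The segment lies in the unit square, in the region v <= u. *)
Definition below (w p k q l : R) : Prop :=
  [/\ 0 <= w <= 1, 0 < k, 0 < l & [/\ 0 <= q, q <= p, q + l * w <= p + k * w & p + k * w <= 1]].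

(** The two integrals entering Spearman's footrule and Spearman's rho. Integrability
    is part of the record to make it stable under sums. *)
Record moments (F : R -> R -> R) (d e : R) : Prop := Moments {
  moments_int1 : mu.-integrable I01 (EFin \o (fun u => F u u)) ;
  moments_int2 : mu2.-integrable (I01 `*` I01) (EFin \o (fun z => F z.1 z.2)) ;
  moments_diag : Rintegral mu I01 (fun u => F u u) = d ;
  moments_full : Rintegral mu2 (I01 `*` I01) (fun z => F z.1 z.2) = e }.

Lemma momentsD F G d e d' e' : moments F d e -> moments G d' e' ->
  moments (fun u v => F u v + G u v) (d + d') (e + e').
Proof.
move=> [F1 F2 Fd Fe] [G1 G2 Gd Ge]; split.
- rewrite (_ : _ \o _ = (EFin \o (fun u => F u u)) \+ (EFin \o (fun u => G u u)))%E.
    exact: integrableD.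
  by apply/funext.
- rewrite (_ : _ \o _ = (EFin \o (fun z => F z.1 z.2)) \+ (EFin \o (fun z => G z.1 z.2)))%E.
    apply: integrableD => //; exact: measurableX.
  by apply/funext.
- by rewrite RintegralD// Fd Gd.
- by rewrite RintegralD ?Fe ?Ge//; exact: measurableX.
Qed.

Lemma momentsZ c F d e : moments F d e ->
  moments (fun u v => c * F u v) (c * d) (c * e).
Proof.
move=> [F1 F2 Fd Fe]; split.
- have := @integrableZl _ _ _ mu I01 (measurable_itv _) c _ F1; exact.
- have := @integrableZl _ _ _ mu2 _ (measurableX (measurable_itv _) (measurable_itv _)) c _ F2; exact.
- by rewrite RintegralZl// Fd.
- by rewrite RintegralZl ?Fe//; exact: measurableX.
Qed.

Lemma moments0 : moments (fun _ _ => 0) 0 0.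
Proof.
split.
- exact: integrable0.
- exact: integrable0.
- by rewrite Rintegral_cst// mul0r.
- by rewrite Rintegral_cst ?mul0r//; exact: measurableX.
Qed.

Lemma moments_sum n (F : nat -> R -> R -> R) d e :
  (forall i, (i < n)%N -> moments (F i) (d i) (e i)) ->
  moments (fun u v => \sum_(i < n) F i u v) (\sum_(i < n) d i) (\sum_(i < n) e i).
Proof.
elim: n => [|n IH] H.
  rewrite !big_ord0; have -> : (fun u v : R => \sum_(i < 0) F i u v) = (fun _ _ => 0).
    by apply/funext => u; apply/funext => v; rewrite big_ord0.
  exact: moments0.
have -> : (fun u v : R => \sum_(i < n.+1) F i u v) =
          (fun u v => \sum_(i < n) F i u v + F n u v).
  by apply/funext => u; apply/funext => v; rewrite big_ord_recr.
rewrite !big_ord_recr/=; apply: momentsD; last exact: H.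
by apply: IH => i i_n; apply: H; exact: ltnW.
Qed.

Lemma eq_moments F G d e :
  (forall u v, 0 <= u <= 1 -> 0 <= v <= 1 -> F u v = G u v) ->
  moments F d e -> moments G d e.
Proof.
move=> FG [F1 F2 Fd Fe].
have D1 u : u \in I01 -> F u u = G u u.
  by rewrite inE/= in_itv/= => u01; exact: FG.
have D2 z : z \in I01 `*` I01 -> F z.1 z.2 = G z.1 z.2.
  by rewrite inE/= !in_itv/= => -[z1 z2]; exact: FG.
split.
- by apply: eq_integrable F1 => // u uI /=; rewrite D1.
- by apply: eq_integrable F2 => //; [exact: measurableX | move=> u uI /=; rewrite D2].
- by rewrite -Fd; apply: eq_Rintegral => u uI; rewrite D1.
- by rewrite -Fe; apply: eq_Rintegral => u uI; rewrite D2.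
Qed.

Lemma moments_phi F d e : moments F d e -> phi F = 6 * d - 2.
Proof. by move=> [_ _ dE _]; rewrite /phi dE. Qed.

Lemma moments_rho F d e : moments F d e -> rho F = 12 * e - 3.
Proof. by move=> [_ _ _ eE]; rewrite /rho eE. Qed.

Lemma segC (w p k q l u v : R) : seg w p k q l u v = seg w q l p k v u.
Proof. by rewrite /seg minC. Qed.

Lemma moments_seg (w p k q l d : R) :
  0 <= w <= 1 -> 0 < k -> 0 < l -> 0 <= p -> p + k * w <= 1 ->
  0 <= q -> q + l * w <= 1 ->
  Rintegral mu I01 (fun u => seg w p k q l u u) = d ->
  moments (seg w p k q l) d
   (w * ((1 - p) * (1 - q) - (1 - p) * l * w / 2 - (1 - q) * k * w / 2
       + k * l * w ^+ 2 / 3)).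
Proof.
move=> /andP[w0 w1] k0 l0 p0 pw q0 qw dE; split => //.
- apply: (@bounded_integrable _ _ _ _ _ 1) => //.
  + by rewrite [X in (X < _)%E]lebesgue_itv01 ltry.
  + by apply: measurable_minr; exact: measurable_ramp.
  + move=> u _; rewrite /seg le_min !ramp_ge0/= ge_min.
    by rewrite (le_trans (ramp_le _ _ _ w0)).
- apply: (@bounded_integrable _ _ _ _ _ 1) => //.
  + exact: measurableX.
  + by rewrite [X in (X < _)%E]lebesgue2_square ltry.
  + exact: measurable_seg.
  + move=> u _; rewrite /seg le_min !ramp_ge0/= ge_min.
    by rewrite (le_trans (ramp_le _ _ _ w0)).
- by rewrite Rintegral_seg// w0 w1.
Qed.

Lemma moments_twin (w p k q l : R) : below w p k q l ->
  moments (twin w p k q l) (2 * (w * (1 - p) - k * w ^+ 2 / 2))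
  (2 * (w * ((1 - p) * (1 - q) - (1 - p) * l * w / 2 - (1 - q) * k * w / 2
       + k * l * w ^+ 2 / 3))).
Proof.
move=> [w01 k0 l0 [q0 qp qlpk pk]].
have /andP[w0 w1] := w01.
have kw : 0 <= k * w by rewrite mulr_ge0// ltW.
have lw : 0 <= l * w by rewrite mulr_ge0// ltW.
have dE : Rintegral mu I01 (fun u => seg w p k q l u u) = w * (1 - p) - k * w ^+ 2 / 2.
  under eq_Rintegral do rewrite seg_diag_below//.
  by rewrite Rintegral_ramp//; lra.
have dE' : Rintegral mu I01 (fun u => seg w q l p k u u) = w * (1 - p) - k * w ^+ 2 / 2.
  by under eq_Rintegral do rewrite segC.
have p0 : 0 <= p by lra.
have ql1 : q + l * w <= 1 by lra.
have M1 := moments_seg w01 k0 l0 p0 pk q0 ql1 dE.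
have M2 := moments_seg w01 l0 k0 q0 ql1 p0 pk dE'.
have := momentsD M1 M2; rewrite /twin.
set d := (X in moments _ X _ -> _); set e := (X in moments _ _ X -> _).
set d' := (X in _ -> moments _ X _); set e' := (X in _ -> moments _ _ X).
have -> : d = d' by rewrite /d/d'; field.
by have -> : e = e' by rewrite /e/e'; field.
Qed.

Lemma eq_is_copula (C D : R -> R -> R) :
  (forall u v, 0 <= u <= 1 -> 0 <= v <= 1 -> C u v = D u v) ->
  is_copula C -> is_copula D.
Proof.
move=> CD [C0l C0r C1l C1r C2].
have b0 : 0 <= (0 : R) <= 1 by lra.
have b1 : 0 <= (1 : R) <= 1 by lra.
split.
- by move=> v v01; rewrite -CD// C0l.
- by move=> v v01; rewrite -CD// C0r.
- by move=> v v01; rewrite -CD// C1l.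
- by move=> v v01; rewrite -CD// C1r.
- move=> u1 u2 v1 v2 *; rewrite -!CD ?C2//; lra.
Qed.

Definition increasing2 (F : R -> R -> R) := forall u1 u2 v1 v2,
  u1 <= u2 -> v1 <= v2 -> 0 <= F u2 v2 - F u2 v1 - F u1 v2 + F u1 v1.

(** What survives in a sum of partial masses: such a sum is a copula as soon as the
    functions m add up to the identity of [0, 1]. *)
Record margins (F : R -> R -> R) (m : R -> R) : Prop := Margins {
  margins_incr : increasing2 F ;
  margins_0l : forall v, F 0 v = 0 ;
  margins_0r : forall u, F u 0 = 0 ;
  margins_1l : forall v, F 1 v = m v ;
  margins_1r : forall u, F u 1 = m u }.

Lemma increasing2D F G : increasing2 F -> increasing2 G ->
  increasing2 (fun u v => F u v + G u v).
Proof.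
move=> HF HG u1 u2 v1 v2 u12 v12.
by have := HF _ _ _ _ u12 v12; have := HG _ _ _ _ u12 v12; lra.
Qed.

Lemma marginsD F G m m' : margins F m -> margins G m' ->
  margins (fun u v => F u v + G u v) (fun t => m t + m' t).
Proof.
move=> [iF lF rF LF RF] [iG lG rG LG RG]; split=> [|v|v|v|v].
- exact: increasing2D.
- by rewrite lF lG addr0.
- by rewrite rF rG addr0.
- by rewrite LF LG.
- by rewrite RF RG.
Qed.

(** Adding segments never destroys 2-monotonicity, so that only the margins of a
    sum of segments remain to be checked. *)
Lemma margins_copula F m : margins F m ->
  (forall t, 0 <= t <= 1 -> m t = t) -> is_copula F.
Proof.
move=> [iF lF rF LF RF] mE; split=> [v _|v _|v v01|v v01|].
- exact: lF.
- exact: rF.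
- by rewrite LF mE.
- by rewrite RF mE.
- by move=> u1 u2 v1 v2 _ u12 _ _ v12 _; exact: iF.
Qed.

Lemma le_ramp (w p k : R) u u' : 0 < k -> u <= u' -> ramp w p k u <= ramp w p k u'.
Proof.
move=> k0 uu'; rewrite /ramp /clamp.
have : (u - p) / k <= (u' - p) / k by rewrite ler_pM2r ?invr_gt0//; lra.
by move: (_ / k) (_ / k) => t t' ?; case_minmax; lra.
Qed.

Lemma increasing2_twin (w p k q l : R) : 0 < k -> 0 < l -> increasing2 (twin w p k q l).
Proof.
have H w' p' k' q' l' : 0 < k' -> 0 < l' -> increasing2 (seg w' p' k' q' l').
  move=> k0 l0 u1 u2 v1 v2 u12 v12; rewrite /seg.
  have := le_ramp w' p' k0 u12; have := le_ramp w' q' l0 v12.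
  move: (ramp _ _ _ _) (ramp _ _ _ _) (ramp _ _ _ _) (ramp _ _ _ _) => a b c d.
  by move=> ab cd; case_minmax; lra.
by move=> k0 l0; apply: increasing2D; exact: H.
Qed.

Lemma ramp_le0 (w p k : R) u : 0 < k -> u <= p -> ramp w p k u = 0.
Proof.
move=> k0 up; rewrite /ramp /clamp max_l// ge_min; apply/orP; right.
by rewrite pmulr_lle0 ?invr_gt0//; lra.
Qed.

Lemma ramp_ge (w p k : R) u : 0 <= w -> 0 < k -> p + k * w <= u -> ramp w p k u = w.
Proof.
move=> w0 k0 up; rewrite /ramp /clamp min_l ?max_r//.
by rewrite ler_pdivlMr// mulrC; lra.
Qed.

Lemma margins_twin (w p k q l : R) : below w p k q l ->
  margins (twin w p k q l) (fun t => ramp w p k t + ramp w q l t).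
Proof.
move=> [/andP[w0 w1] k0 l0 [q0 qp qlpk pk]].
have p0 : 0 <= p by lra.
have ql1 : q + l * w <= 1 by lra.
have r0 p' k' u : Num.min 0 (ramp w p' k' u) = 0 by rewrite min_l// ramp_ge0.
have r1 p' k' u : Num.min w (ramp w p' k' u) = ramp w p' k' u by rewrite min_r// ramp_le.
split; first exact: increasing2_twin.
- by move=> v; rewrite /twin /seg !(@ramp_le0 _ _ _ 0)// !r0 addr0.
- by move=> v; rewrite /twin /seg !(@ramp_le0 _ _ _ 0)// ![Num.min _ 0]minC !r0 addr0.
- by move=> v; rewrite /twin /seg !(@ramp_ge _ _ _ 1)// !r1 addrC.
- by move=> v; rewrite /twin /seg !(@ramp_ge _ _ _ 1)// ![Num.min _ w]minC !r1 addrC.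
Qed.

End copulas.

(** * The copulas E_a and the family between E_(1/4) and the shuffle of parameter 4 *)

(** Two clamped piecewise linear functions are compared on an interval where both
    are linear: they agree there, or both are cut off on the same side. *)
Ltac clamp_congr := apply: eq_clamp; first [by lra | by constructor 1; lra
  | by constructor 2; lra | by constructor 3; lra].

Section families.
Variable R : realType.

(** The mass of the copula E_a below the diagonal lies on three consecutive
    increasing segments, from (a, 0) to (1 - a, 1/2 - a), then to (1/2 + a, a), then
    to (1, 1 - a). *)
Definition E_twins (a : R) (u v : R) : R :=
  twin (1 / 2 - a) a 2 0 1 u v + twin (2 * a - 1 / 2) (1 - a) 1 (1 / 2 - a) 1 u v
  + twin (1 / 2 - a) (1 / 2 + a) 1 a 2 u v.

Lemma below_E_twins (a : R) : 1 / 4 <= a <= 1 / 2 ->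
  [/\ below (1 / 2 - a) a 2 0 1,
      below (2 * a - 1 / 2) (1 - a) 1 (1 / 2 - a) 1 &
      below (1 / 2 - a) (1 / 2 + a) 1 a 2].
Proof. by move=> /andP[a0 a1]; split; do ?split; lra. Qed.

(** Cutting the range [0, c3] at c1 and c2 cuts the minimum of two quantities
    accordingly, because clamping is monotone. Applied to the two margins of a chain
    of increasing segments it cuts the chain into its segments. *)
Lemma min_chain (c1 c2 c3 x y : R) : 0 <= c1 -> c1 <= c2 -> c2 <= c3 ->
  0 <= x -> x <= c3 -> 0 <= y -> y <= c3 ->
  Num.min x y =
    Num.min (clamp c1 x) (clamp c1 y)
  + Num.min (clamp (c2 - c1) (x - c1)) (clamp (c2 - c1) (y - c1))
  + Num.min (clamp (c3 - c2) (x - c2)) (clamp (c3 - c2) (y - c2)).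
Proof.
move=> c10 c12 c23 x0 x3 y0 y3.
have [xy|/ltW yx] := leP x y.
  by rewrite !min_l ?le_clamp ?lerB//; exact: clamp_chain.
by rewrite !min_r ?le_clamp ?lerB//; exact: clamp_chain.
Qed.

Lemma delta_up_bounds (a t : R) : 0 <= a <= 1 / 2 -> 0 <= t <= 1 ->
  [/\ 0 <= delta_up a t, delta_up a t <= t & 2 * t - 1 <= delta_up a t].
Proof.
rewrite /delta_up => /andP[a0 a1] /andP[t0 t1].
by case: (leP t a) => ?; [|case: (leP t (1 - a)) => ?]; split; lra.
Qed.

Lemma E_copE (a u v : R) : 1 / 4 <= a <= 1 / 2 -> 0 <= u <= 1 -> 0 <= v <= 1 ->
  E_cop a u v = E_twins a u v.
Proof.
move=> /andP[a0 a1].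
have a01 : 0 <= a <= 1 / 2 by lra.
(* Each term is the mass carried by one side of the diagonal; delta_up a is below
   the identity, so that the minimum in E_cop is always reached by this sum. *)
have E_min (s t : R) : 0 <= s <= 1 -> 0 <= t <= 1 -> E_cop a s t =
    Num.min (delta_up a s / 2) (t - delta_up a t / 2) +
    Num.min (delta_up a t / 2) (s - delta_up a s / 2).
  move=> s01 t01; rewrite /E_cop.
  by have [_ + _] := delta_up_bounds a01 s01; have [_ + _] := delta_up_bounds a01 t01; case_minmax; lra.
(* The six clamped margins are the ramps of the three segments: p1, p2, p3 give
   abscissas and q1, q2, q3 ordinates. *)
have p1 (t : R) : 0 <= t <= 1 -> clamp (1 / 2 - a) (delta_up a t / 2) =
    ramp (1 / 2 - a) a 2 t.
  by rewrite /delta_up /ramp => /andP[? ?]; case: (leP t a) => ?; [|case: (leP t (1 - a)) => ?]; clamp_congr.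
have q1 (t : R) : 0 <= t <= 1 -> clamp (1 / 2 - a) (t - delta_up a t / 2) =
    ramp (1 / 2 - a) 0 1 t.
  by rewrite /delta_up /ramp => /andP[? ?]; case: (leP t a) => ?; [|case: (leP t (1 - a)) => ?]; clamp_congr.
have p2 (t : R) : 0 <= t <= 1 ->
    clamp (2 * a - 1 / 2) (delta_up a t / 2 - (1 / 2 - a)) =
    ramp (2 * a - 1 / 2) (1 - a) 1 t.
  by rewrite /delta_up /ramp => /andP[? ?]; case: (leP t a) => ?; [|case: (leP t (1 - a)) => ?]; clamp_congr.
have q2 (t : R) : 0 <= t <= 1 ->
    clamp (2 * a - 1 / 2) (t - delta_up a t / 2 - (1 / 2 - a)) =
    ramp (2 * a - 1 / 2) (1 / 2 - a) 1 t.
  by rewrite /delta_up /ramp => /andP[? ?]; case: (leP t a) => ?; [|case: (leP t (1 - a)) => ?]; clamp_congr.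
have p3 (t : R) : 0 <= t <= 1 ->
    clamp (1 / 2 - a) (delta_up a t / 2 - a) =
    ramp (1 / 2 - a) (1 / 2 + a) 1 t.
  by rewrite /delta_up /ramp => /andP[? ?]; case: (leP t a) => ?; [|case: (leP t (1 - a)) => ?]; clamp_congr.
have q3 (t : R) : 0 <= t <= 1 ->
    clamp (1 / 2 - a) (t - delta_up a t / 2 - a) =
    ramp (1 / 2 - a) a 2 t.
  by rewrite /delta_up /ramp => /andP[? ?]; case: (leP t a) => ?; [|case: (leP t (1 - a)) => ?]; clamp_congr.
have half (s t : R) : 0 <= s <= 1 -> 0 <= t <= 1 ->
    Num.min (delta_up a s / 2) (t - delta_up a t / 2) =
    seg (1 / 2 - a) a 2 0 1 s t + seg (2 * a - 1 / 2) (1 - a) 1 (1 / 2 - a) 1 s t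
    + seg (1 / 2 - a) (1 / 2 + a) 1 a 2 s t.
  move=> s01 t01.
  have [? ? ?] := delta_up_bounds a01 s01; have [? ? ?] := delta_up_bounds a01 t01.
  rewrite (@min_chain (1 / 2 - a) a (1 / 2)); try lra.
  have -> : a - (1 / 2 - a) = 2 * a - 1 / 2 by lra.
  by rewrite /seg p1// p2// p3// q1// q2// q3.
move=> u01 v01; rewrite E_min// half// half// /E_twins /twin.
rewrite !(@segC _ _ _ _ _ _ v); ring.
Qed.

Lemma E_copC (a u v : R) : E_cop a u v = E_cop a v u.
Proof. by rewrite /E_cop [Num.min v u]minC addrC. Qed.

Lemma E_cop_is_copula (a : R) : 1 / 4 <= a <= 1 / 2 -> is_copula (E_cop a).
Proof.
move=> a01; have [b1 b2 b3] := below_E_twins a01.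
have a01' : 0 <= a <= 1 / 2 by case/andP: a01 => ? ?; lra.
have b0 : 0 <= (0 : R) <= 1 by lra.
have b1' : 0 <= (1 : R) <= 1 by lra.
have d0 : delta_up a 0 = 0 by have [] := delta_up_bounds a01' b0; lra.
have d1 : delta_up a 1 = 1 by have [] := delta_up_bounds a01' b1'; lra.
have E0 v : 0 <= v <= 1 -> E_cop a 0 v = 0.
  move=> v01; have [h _ _] := delta_up_bounds a01' v01; case/andP: v01 => v0 v1.
  by rewrite /E_cop d0; case_minmax; lra.
have E1 v : 0 <= v <= 1 -> E_cop a 1 v = v.
  move=> v01; have [_ _ h] := delta_up_bounds a01' v01; case/andP: v01 => v0 v1.
  by rewrite /E_cop d1; case_minmax; lra.
split=> // [u u01|u u01|u1 u2 v1 v2 u10 u12 u21 v10 v12 v21].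
- by rewrite E_copC E0.
- by rewrite E_copC E1.
- rewrite !E_copE//; try lra.
  exact: (increasing2D (increasing2D (margins_incr (margins_twin b1))
    (margins_incr (margins_twin b2))) (margins_incr (margins_twin b3))).
Qed.

(** A copula interpolating between E_(1/4), for c = 1/4, and the shuffle of
    parameter 4, for c = 0. Under its law |X - Y| - 1/4 vanishes with probability
    1 - 4c and is otherwise uniform on [0, c]; the twins of weight 1/4 - c carry the
    first part, where |X - Y| = 1/4, and the twins of weight c the second one. *)
Definition bridge (c u v : R) : R :=
  twin (1 / 4 - c) (1 / 4) 1 0 1 u v + twin c (1 / 2 - c) 2 (1 / 4 - c) 1 u v
  + (twin c (3 / 4) 1 (1 / 2 - c) 2 u v + twin (1 / 4 - c) (3 / 4 + c) 1 (1 / 2 + c) 1 u v).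

Lemma below_bridge (c : R) : 0 <= c <= 1 / 4 ->
  (below (1 / 4 - c) (1 / 4) 1 0 1 /\ below c (1 / 2 - c) 2 (1 / 4 - c) 1) /\
  (below c (3 / 4) 1 (1 / 2 - c) 2 /\ below (1 / 4 - c) (3 / 4 + c) 1 (1 / 2 + c) 1).
Proof. by move=> /andP[c0 c1]; split; split; split; do ?split; lra. Qed.

Lemma bridge_is_copula (c : R) : 0 <= c <= 1 / 4 -> is_copula (bridge c).
Proof.
move=> c01; have [[b1 b2] [b3 b4]] := below_bridge c01.
apply: (margins_copula (marginsD (marginsD (margins_twin b1) (margins_twin b2))
   (marginsD (margins_twin b3) (margins_twin b4)))) => v v01.
case/andP: c01 => c0 c1; case/andP: v01 => v0 v1.
rewrite /ramp subr0 !divr1.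
(* The eight ramps are regrouped by adjacency into the masses of [0, 1/4],
   [1/4, 3/4] and [3/4, 1]; on [1/2 - c, 1/2 + c] two ramps of density 1/2 overlap. *)
have e1 : clamp (1 / 4 - c) v + clamp c (v - (1 / 4 - c)) = clamp (1 / 4) v.
  by rewrite clampD; [congr clamp| |]; lra.
have e2 : clamp (1 / 4 - c) (v - 1 / 4) + 2 * clamp c ((v - (1 / 2 - c)) / 2)
   + clamp (1 / 4 - c) (v - (1 / 2 + c)) = clamp (1 / 2) (v - 1 / 4).
  have -> : v - (1 / 2 + c) = v - 1 / 4 - (1 / 4 - c + 2 * c) by lra.
  have -> : 2 * clamp c ((v - (1 / 2 - c)) / 2) = clamp (2 * c) (v - 1 / 4 - (1 / 4 - c)).
    by rewrite clampM//; congr clamp; lra.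
  by rewrite !clampD; [congr clamp| | | |]; lra.
have e3 : clamp c (v - 3 / 4) + clamp (1 / 4 - c) (v - (3 / 4 + c)) = clamp (1 / 4) (v - 3 / 4).
  have -> : v - (3 / 4 + c) = v - 3 / 4 - c by lra.
  by rewrite clampD; [congr clamp| |]; lra.
have : v = clamp (1 / 4) v + clamp (3 / 4 - 1 / 4) (v - 1 / 4) + clamp (1 - 3 / 4) (v - 3 / 4).
  by apply: clamp_chain; lra.
have -> : 3 / 4 - 1 / 4 = 1 / 2 :> R by lra.
have -> : 1 - 3 / 4 = 1 / 4 :> R by lra.
by lra.
Qed.

Lemma moments_bridge (c : R) : 0 <= c <= 1 / 4 ->
  moments (bridge c) (3 / 8 - c ^+ 2) (29 / 96 - c ^+ 2 / 2 - 2 / 3 * c ^+ 3).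
Proof.
move=> c01; have [[b1 b2] [b3 b4]] := below_bridge c01.
have := momentsD (momentsD (moments_twin b1) (moments_twin b2))
   (momentsD (moments_twin b3) (moments_twin b4)).
rewrite /bridge.
set d := (X in moments _ X _ -> _); set e := (X in moments _ _ X -> _).
have -> : d = 3 / 8 - c ^+ 2 by rewrite /d; field.
by have -> : e = 29 / 96 - c ^+ 2 / 2 - 2 / 3 * c ^+ 3 by rewrite /e; field.
Qed.

End families.

(** * Ordinal sums *)

Section ordinal_sums.
Variable R : realType.

(** The ordinal sum of N copies of C with respect to the N equal subintervals of
    [0, 1]. Writing it as a sum of rescaled copulas, clamped outside of their block,
    lets the ordinal sum inherit margins, monotonicity and segment decompositions
    termwise. *)
Definition osum (N : nat) (C : R -> R -> R) (u v : R) : R :=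
  N%:R^-1 * \sum_(i < N) C (clamp 1 (N%:R * u - i%:R)) (clamp 1 (N%:R * v - i%:R)).

Lemma osum_is_copula N C : (0 < N)%N -> is_copula C -> is_copula (osum N C).
Proof.
move=> N0 [C0l C0r C1l C1r C2].
have NR : 0 < N%:R :> R by rewrite ltr0n.
have c0 (i : 'I_N) : clamp 1 (N%:R * 0 - i%:R) = 0 :> R.
  by have [|[h ->]|[h ->]|[h ->]] := @clampP _ 1 (N%:R * 0 - i%:R : R); have := ler0n R i; lra.
have c1 (i : 'I_N) : clamp 1 (N%:R * 1 - i%:R) = 1 :> R.
  have : i%:R + 1 <= N%:R :> R by rewrite natr1 ler_nat.
  by have [|[h ->]|[h ->]|[h ->]] := @clampP _ 1 (N%:R * 1 - i%:R : R); lra.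
have sumt (t : R) : 0 <= t <= 1 -> N%:R^-1 * \sum_(i < N) clamp 1 (N%:R * t - i%:R) = t.
  by move=> t01; rewrite mean_clamp// mulKf ?gt_eqF.
split.
- move=> v v01; rewrite /osum big1 => [|i _]; first exact: mulr0.
  by rewrite c0 C0l// clamp1_itv.
- move=> v v01; rewrite /osum big1 => [|i _]; first exact: mulr0.
  by rewrite c0 C0r// clamp1_itv.
- move=> v v01; rewrite /osum -[RHS]sumt//; congr (_ * _); apply: eq_bigr => i _.
  by rewrite c1 C1l// clamp1_itv.
- move=> v v01; rewrite /osum -[RHS]sumt//; congr (_ * _); apply: eq_bigr => i _.
  by rewrite c1 C1r// clamp1_itv.
- move=> u1 u2 v1 v2 u10 u12 u21 v10 v12 v21.
  rewrite /osum -!mulrBr -mulrDr; apply: mulr_ge0; first by rewrite invr_ge0 ltW.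
  rewrite -!sumrB -big_split/=; apply: sumr_ge0 => i _.
  have /andP[? ?] := clamp1_itv (N%:R * u1 - i%:R).
  have /andP[? ?] := clamp1_itv (N%:R * u2 - i%:R).
  have /andP[? ?] := clamp1_itv (N%:R * v1 - i%:R).
  have /andP[? ?] := clamp1_itv (N%:R * v2 - i%:R).
  by apply: C2 => //; apply: le_clamp; rewrite lerB// ler_wpM2l// ltW.
Qed.

Lemma ramp_scale N i (w p k u : R) : (0 < N)%N -> 0 <= w -> 0 < k -> 0 <= p ->
  p + k * w <= 1 ->
  N%:R^-1 * ramp w p k (clamp 1 (N%:R * u - i%:R)) = ramp (w / N%:R) ((i%:R + p) / N%:R) k u.
Proof.
move=> N0 w0 k0 p0 pk1.
have NR : 0 < N%:R :> R by rewrite ltr0n.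
have kw0 : 0 <= k * w by rewrite mulr_ge0// ltW.
have -> : ramp w p k (clamp 1 (N%:R * u - i%:R)) = ramp w p k (N%:R * u - i%:R).
  have [|[h ->]|[h ->]|[h ->]]// := @clampP _ 1 (N%:R * u - i%:R : R).
    by rewrite !ramp_le0//; lra.
  by rewrite !ramp_ge//; lra.
rewrite /ramp /clamp maxr_pMr ?invr_ge0 ?ltW// minr_pMr ?invr_ge0 ?ltW// mulr0.
congr (Num.max _ (Num.min _ _)); first by rewrite mulrC.
by field; rewrite !gt_eqF.
Qed.

(** Rescaling into the i-th block moves and shrinks the segment but keeps its densities. *)
Lemma twin_scale N i (w p k q l u v : R) : (0 < N)%N -> below w p k q l ->
  N%:R^-1 * twin w p k q l (clamp 1 (N%:R * u - i%:R)) (clamp 1 (N%:R * v - i%:R)) =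
  twin (w / N%:R) ((i%:R + p) / N%:R) k ((i%:R + q) / N%:R) l u v.
Proof.
move=> N0 [/andP[w0 w1] k0 l0 [q0 qp qlpk pk]].
have NR : 0 <= N%:R^-1 :> R by rewrite invr_ge0.
by rewrite /twin /seg mulrDr !minr_pMr// !ramp_scale//; lra.
Qed.

Lemma below_scale N i (w p k q l : R) : (i < N)%N -> below w p k q l ->
  below (w / N%:R) ((i%:R + p) / N%:R) k ((i%:R + q) / N%:R) l.
Proof.
move=> iN [/andP[w0 w1] k0 l0 [q0 qp qlpk pk]].
have N0 : 0 < N%:R :> R by rewrite ltr0n (leq_trans _ iN).
have iN1 : i%:R + 1 <= N%:R :> R by rewrite natr1 ler_nat.
have i0 := ler0n R i.
split=> //; last split.
- by apply/andP; split; [apply: divr_ge0; lra | rewrite ler_pdivrMr// mul1r; lra].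
- by apply: divr_ge0; lra.
- by rewrite ler_pM2r ?invr_gt0//; lra.
- by rewrite !mulrA -!mulrDl ler_pM2r ?invr_gt0//; lra.
- by rewrite !mulrA -!mulrDl ler_pdivrMr// mul1r; lra.
Qed.

Lemma sum_quadratic n (A B C : R) :
  \sum_(i < n) (A + B * i%:R + C * i%:R ^+ 2) =
  A * n%:R + B * (n%:R * (n%:R - 1) / 2) + C * (n%:R * (n%:R - 1) * (2 * n%:R - 1) / 6).
Proof.
elim: n => [|n IH]; first by rewrite big_ord0; ring.
by rewrite big_ord_recr/= IH -natr1; field.
Qed.

Lemma E_cop_scale (a : R) N i (u v : R) : 1 / 4 <= a <= 1 / 2 -> (0 < N)%N ->
  N%:R^-1 * E_cop a (clamp 1 (N%:R * u - i%:R)) (clamp 1 (N%:R * v - i%:R)) =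
    twin ((1 / 2 - a) / N%:R) ((i%:R + a) / N%:R) 2 ((i%:R + 0) / N%:R) 1 u v
  + twin ((2 * a - 1 / 2) / N%:R) ((i%:R + (1 - a)) / N%:R) 1 ((i%:R + (1 / 2 - a)) / N%:R) 1 u v
  + twin ((1 / 2 - a) / N%:R) ((i%:R + (1 / 2 + a)) / N%:R) 1 ((i%:R + a) / N%:R) 2 u v.
Proof.
move=> a01 N0; have [b1 b2 b3] := below_E_twins a01.
by rewrite E_copE// ?clamp1_itv// /E_twins 2!mulrDr !twin_scale.
Qed.

Lemma moments_osum (a : R) N : 1 / 4 <= a <= 1 / 2 -> (0 < N)%N ->
  moments (osum N (E_cop a)) (1 / 2 - (a - a ^+ 2) / N%:R)
   (1 / 3 - (a - 4 / 3 * a ^+ 3 - 1 / 12) / (2 * N%:R ^+ 2)).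
Proof.
move=> a01 N0; have [b1 b2 b3] := below_E_twins a01.
have NR : N%:R != 0 :> R by rewrite pnatr_eq0 -lt0n.
have M i : (i < N)%N -> _ := fun iN => momentsD (momentsD (moments_twin (below_scale iN b1))
    (moments_twin (below_scale iN b2))) (moments_twin (below_scale iN b3)).
have := moments_sum M; set F := (X in moments X).
have -> : F = osum N (E_cop a).
  apply/funext => u; apply/funext => v; rewrite /osum mulr_sumr.
  by apply: eq_bigr => i _; rewrite E_cop_scale.
set d := (X in moments _ X _ -> _); set e := (X in moments _ _ X -> _).
have -> : d = 1 / 2 - (a - a ^+ 2) / N%:R.
  transitivity (\sum_(i < N) ((1 / N%:R - (1 / 2 + a - a ^+ 2) / N%:R ^+ 2)
      + (- 1 / N%:R ^+ 2) * i%:R + 0 * i%:R ^+ 2)).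
    by apply: eq_bigr => i _; field.
  by rewrite sum_quadratic; field.
have -> //: e = 1 / 3 - (a - 4 / 3 * a ^+ 3 - 1 / 12) / (2 * N%:R ^+ 2).
  pose A : R := 1 / N%:R - 1 / N%:R ^+ 2 + (3 / 8 - a / 2 + 2 / 3 * a ^+ 3) / N%:R ^+ 3.
  pose B : R := 1 / N%:R ^+ 3 - 2 / N%:R ^+ 2.
  pose C : R := 1 / N%:R ^+ 3.
  transitivity (\sum_(i < N) (A + B * i%:R + C * i%:R ^+ 2)).
    by apply: eq_bigr => i _; rewrite /A /B /C; field.
  by rewrite sum_quadratic /A /B /C; field.
Qed.

End ordinal_sums.

(** * The copulas O and the shuffles as ordinal sums *)

Section members.
Variable R : realType.
Local Notation mu := (@lebesgue_measure R).

(** If no block contains both arguments, then in every block one of the rescaled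
    arguments is 0 or 1, and the copula boundary conditions give the minimum. *)
Lemma osum_off_block N (C : R -> R -> R) (u v : R) : (0 < N)%N -> is_copula C ->
  0 <= u -> u <= v -> v <= 1 ->
  (forall i : 'I_N, ~ (i%:R < N%:R * u /\ N%:R * v < i%:R + 1)) ->
  osum N C u v = u.
Proof.
move=> N0 [C0l _ _ C1r _] u0 uv v1 off.
have NR : 0 < N%:R :> R by rewrite ltr0n.
have NN : N%:R != 0 :> R by rewrite gt_eqF.
have Nuv : N%:R * u <= N%:R * v by rewrite ler_pM2l.
rewrite /osum (eq_bigr (fun i : 'I_N => clamp 1 (N%:R * u - i%:R))) => [|i _].
  by rewrite mean_clamp ?mulKf//; lra.
have [//|[h e]|[h e]|[h e]] := @clampP _ 1 (N%:R * u - i%:R).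
- by rewrite e C0l// clamp1_itv.
- have [iu|ui] := ltP i%:R (N%:R * u).
    have vi : i%:R + 1 <= N%:R * v.
      by rewrite leNgt; apply/negP => vi; exact: (off i).
    have -> : clamp 1 (N%:R * v - i%:R) = 1.
      by have [|[h' ->]|[h' ->]|[h' ->]] := @clampP _ 1 (N%:R * v - i%:R); lra.
    by rewrite C1r// clamp1_itv.
  have -> : clamp 1 (N%:R * u - i%:R) = 0 by rewrite e; lra.
  by rewrite C0l// clamp1_itv.
- have -> : clamp 1 (N%:R * v - i%:R) = 1.
    by have [|[h' ->]|[h' ->]|[h' ->]] := @clampP _ 1 (N%:R * v - i%:R); lra.
  by rewrite C1r// clamp1_itv.
Qed.

(** Every block before the k-th one is full and every later one is empty. *)
Lemma osum_on_block N (C : R -> R -> R) (u v : R) (k : 'I_N) : is_copula C ->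
  k%:R <= N%:R * u <= k%:R + 1 -> k%:R <= N%:R * v <= k%:R + 1 ->
  osum N C u v = k%:R / N%:R + N%:R^-1 * C (N%:R * u - k%:R) (N%:R * v - k%:R).
Proof.
move=> [C0l _ C1l _ _] /andP[uk ku] /andP[vk kv].
have N0 : (0 < N)%N by exact: leq_ltn_trans (ltn_ord k).
have NR : 0 < N%:R :> R by rewrite ltr0n.
have kN : k%:R + 1 <= N%:R :> R by rewrite natr1 ler_nat.
have k0 := ler0n R k.
have u01 : 0 <= u <= 1.
  by apply/andP; split; [rewrite -(pmulr_rge0 _ NR) | rewrite -(ler_pM2l NR) mulr1]; lra.
rewrite /osum (bigD1 k)//= !clamp1E; [|lra|lra].
rewrite (eq_bigr (fun i : 'I_N => clamp 1 (N%:R * u - i%:R))) => [|i ik].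
  have := mean_clamp N0 u01; rewrite (bigD1 k)//= clamp1E; last by lra.
  move=> /(canRL (addKr _)) ->; rewrite mulrDr addrC; congr (_ + _).
  by field; rewrite gt_eqF.
have [ik'|ki] := leqP i.+1 k.
  have ik1 : i%:R + 1 <= k%:R :> R by rewrite natr1 ler_nat.
  have e (w : R) : k%:R <= N%:R * w -> clamp 1 (N%:R * w - i%:R) = 1.

    by move=> ?; have [|[h' ->]|[h' ->]|[h' ->]] := @clampP _ 1 (N%:R * w - i%:R); lra.
  by rewrite !e// C1l//; lra.
have ki1 : k%:R + 1 <= i%:R :> R.
  by rewrite natr1 ler_nat ltn_neqAle eq_sym; rewrite -ltnS ki andbT; exact: ik.
have e (w : R) : N%:R * w <= k%:R + 1 -> clamp 1 (N%:R * w - i%:R) = 0.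
  by move=> ?; have [|[h' ->]|[h' ->]|[h' ->]] := @clampP _ 1 (N%:R * w - i%:R); lra.
by rewrite !e// C0l//; lra.
Qed.

Lemma osumC N (C : R -> R -> R) u v : (forall s t, C s t = C t s) ->
  osum N C u v = osum N C v u.
Proof. by move=> CC; rewrite /osum; congr (_ * _); apply: eq_bigr => i _; rewrite CC. Qed.

Lemma O_copE (a u v : R) N : 1 / 4 <= a <= 1 / 2 -> (0 < N)%N ->
  0 <= u <= 1 -> 0 <= v <= 1 -> O_cop a N u v = osum N (E_cop a) u v.
Proof.
move=> a01 N0 /andP[u0 u1] /andP[v0 v1].
have NR : 0 < N%:R :> R by rewrite ltr0n.
have EC := E_cop_is_copula a01.
have scale (k : 'I_N) (t : R) : (k%:R / N%:R < t < k.+1%:R / N%:R) =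
    (k%:R < N%:R * t < k%:R + 1).
  by rewrite ltr_pdivrMr// ltr_pdivlMr// natr1 mulrC.
rewrite /O_cop; case: pickP => [k|off].
  rewrite !scale => /andP[/andP[uk ku] /andP[vk kv]].
  by rewrite (@osum_on_block _ _ _ _ k)//; lra.
have off' (s t : R) (i : 'I_N) : s <= t -> (s = u /\ t = v) \/ (s = v /\ t = u) ->
    ~ (i%:R < N%:R * s /\ N%:R * t < i%:R + 1).
  move=> st uv [is' ti]; have Nst : N%:R * s <= N%:R * t by rewrite ler_pM2l.
  move: (off i); rewrite !scale => /negP; apply; apply/andP.
  by case: uv => -[su tv]; subst s t; split; lra.
have [uv|/ltW vu] := leP u v.
  by rewrite osum_off_block// => i; apply: off' => //; left.
by rewrite (osumC _ _ _ (E_copC a)) osum_off_block// => i; apply: off' => //; right.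
Qed.

Lemma block_inj n (i j : nat) (x : R) : (0 < n)%N ->
  i%:R / n%:R < x < i.+1%:R / n%:R -> j%:R / n%:R < x < j.+1%:R / n%:R -> i = j.
Proof.
rewrite -(ltr0n R) => n0.
rewrite !ltr_pdivrMr// !ltr_pdivlMr// => /andP[ix xi] /andP[jx xj].
have ij : (i < j.+1)%N by rewrite -(ltr_nat R); lra.
have ji : (j < i.+1)%N by rewrite -(ltr_nat R); lra.
by apply/eqP; rewrite eqn_leq -ltnS ij -ltnS ji.
Qed.

Lemma shuffle_block n (f : nat -> nat) (i : nat) (x : R) : (i < n)%N ->
  i%:R / n%:R < x < i.+1%:R / n%:R ->
  shuffle n f x = x - (i.+1%:R - (f i.+1)%:R) / n%:R.
Proof.
move=> i_n xi; have n0 := leq_ltn_trans (leq0n i) i_n.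
rewrite /shuffle; congr (_ - _); rewrite big_add1/= big_mkord.
rewrite (bigD1 (Ordinal i_n))//= xi big1 ?addr0// => j ji.
case: ifPn => // xj; move: ji; rewrite -val_eqE/= => /eqP[].
exact: block_inj xj xi.
Qed.

Lemma lebesgue_measure_cut_itv (a b c : R) : a <= c ->
  mu [set x | a < x < c /\ x <= b] = (clamp (c - a) (b - a))%:E.
Proof.
move=> ac; have [bc|cb] := ltP b c.
  have -> : [set x | a < x < c /\ x <= b] = `]a, b]%classic.
    apply/seteqP; split => x /=; rewrite in_itv/=.
      by move=> [/andP[-> _] ->].
    by move=> /andP[ax xb]; split=> //; lra.
  rewrite lebesgue_measure_itv/= lte_fin; case: ltP => ab.
    by rewrite EFinN; congr (_%:E); rewrite /clamp min_r ?max_r; lra.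
  by congr (_%:E); rewrite /clamp min_r ?max_l; lra.
have -> : [set x | a < x < c /\ x <= b] = `]a, c[%classic.
  apply/seteqP; split => x /=; rewrite in_itv/=; first by case.
  by move=> /andP[ax xc]; split; lra.
rewrite lebesgue_measure_itv/= lte_fin; case: ltP => ab.
  by congr (_%:E); rewrite /clamp min_l ?max_r; lra.
by congr (_%:E); rewrite /clamp min_l ?max_l; lra.
Qed.

(** Each of the n pieces of a shuffle carries a mass 1/n on a segment of slope 1.
    The finitely many endpoints do not contribute to the Lebesgue measure. *)
Lemma shuffle_copulaE n (f : nat -> nat) (u v : R) : (0 < n)%N -> 0 <= u <= 1 ->
  shuffle_copula n f u v = \sum_(i < n)
    seg (1 / n%:R) (i%:R / n%:R) 1 (((f i.+1)%:R - 1) / n%:R) 1 u v.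
Proof.
move=> n0 /andP[u0 u1]; have nR : 0 < n%:R :> R by rewrite ltr0n.
(* P i is the contribution of the open i-th block, E the set of all endpoints. *)
pose A := [set x : R | 0 <= x <= u /\ shuffle n f x <= v].
pose P (i : nat) := [set x : R | i%:R / n%:R < x < i.+1%:R / n%:R /\
   x <= Num.min u (v + (i.+1%:R - (f i.+1)%:R) / n%:R)].
pose E : set R := [set i%:R / n%:R | i in `I_n.+1].
have mP i : measurable (P i).
  have -> : P i = `]i%:R / n%:R, i.+1%:R / n%:R[ `&`
     `]-oo, Num.min u (v + (i.+1%:R - (f i.+1)%:R) / n%:R)].
    by apply/seteqP; split => x /=; rewrite !in_itv/=.
  exact: measurableI.
have cE : countable E by apply: finite_set_countable; exact: finite_image.
have subPA : \bigcup_(i < n) P i `<=` A.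
  move=> x [i /= i_n [xi]]; rewrite le_min => /andP[xu xv].
  rewrite /A/= (shuffle_block f i_n xi); have i0 : 0 <= i%:R / n%:R :> R by rewrite divr_ge0.
  by move: xi => /andP[xi _]; split; [apply/andP; split|]; lra.
have AE : A = \bigcup_(i < n) P i `|` (A `&` E).
  apply/seteqP; split=> [x Ax|x [/subPA//|[]//]].
  have [xE|xE] := pselect (E x); [by right|left].
  case: Ax => /andP[x0 xu] sx.
  have nx0 : 0 <= n%:R * x by rewrite mulr_ge0// ltW.
  have /andP[ix xi] := truncn_itv nx0; set i := Num.trunc _ in ix xi.
  have xn : n%:R * x <= n%:R by rewrite ler_piMr ?(ltW nR)//; lra.
  have i_n : (i < n)%N.
    rewrite ltn_neqAle -(ler_nat R) (le_trans ix xn) andbT; apply/eqP => ein; apply: xE.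
    exists n => //=; rewrite ein in ix.
    have e : n%:R * x = n%:R by apply/le_anti; rewrite xn ix.
    by rewrite -[X in X / _]e mulrC mulKf ?gt_eqF.
  have ix' : i%:R / n%:R < x.
    rewrite ltr_pdivrMr// mulrC lt_neqAle ix andbT; apply/eqP => e; apply: xE.
    by exists i => /=; [exact: ltnW | rewrite e; field; rewrite gt_eqF].
  have xi' : x < i.+1%:R / n%:R by rewrite ltr_pdivlMr// mulrC.
  have xJ : i%:R / n%:R < x < i.+1%:R / n%:R by rewrite ix' xi'.
  exists i => //; split=> //; rewrite le_min xu/=.
  by move: sx; rewrite (shuffle_block f i_n xJ); lra.
have cAE : countable (A `&` E).
  by apply: sub_countable cE; apply: subset_card_le; exact: subIsetr.
rewrite /shuffle_copula -/A AE measureU0; first last.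
- exact: countable_lebesgue_measure0.
- by apply: countable_measurable => // t; exact: measurable_set1.
- by apply: fin_bigcup_measurable => // i _; exact: mP.
rewrite bigcup_mkord measure_bigsetU//; last first.
  move=> i j _ _ [x [[xi _] [xj _]]]; exact: block_inj xi xj.
rewrite (eq_bigr (fun i : 'I_n => (seg (1 / n%:R) (i%:R / n%:R) 1 (((f i.+1)%:R - 1) / n%:R) 1 u v)%:E)).
  by rewrite sumEFin.
move=> i _; transitivity (clamp (i.+1%:R / n%:R - i%:R / n%:R)
    (Num.min u (v + (i.+1%:R - (f i.+1)%:R) / n%:R) - i%:R / n%:R))%:E.
  by apply: lebesgue_measure_cut_itv; rewrite ler_pM2r ?invr_gt0// ler_nat.
congr (_%:E); rewrite /seg /ramp !divr1 -clamp_min addr_minl -!natr1.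
by congr (clamp _ (Num.min _ _)); field; rewrite gt_eqF.
Qed.

Lemma sum_pairs (V : zmodType) n (F : nat -> V) :
  \sum_(i < 2 * n) F i = \sum_(i < n) (F (2 * i)%N + F (2 * i).+1%N).
Proof.
elim: n => [|n IH]; first by rewrite !big_ord0.
by rewrite mulnS !add2n !big_ord_recr/= IH addrA.
Qed.

Lemma twin0 (p k q l u v : R) : twin 0 p k q l u v = 0.
Proof.
have r0 p' k' t : ramp 0 p' k' t = 0 :> R by apply/le_anti; rewrite ramp_ge0 ramp_le.
by rewrite /twin /seg !r0 minxx addr0.
Qed.

(** For a = 1/2 only the middle twin of E_a has mass, so that E_(1/2) is the
    exchange of [0, 1/2] and [1/2, 1]; the shuffle S_(2N) repeats it in N blocks. *)
Lemma S_starE N (u v : R) : (0 < N)%N -> 0 <= u <= 1 ->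
  S_star (2 * N)%N u v = osum N (E_cop (1 / 2)) u v.
Proof.
move=> N0 u01; have NR : N%:R != 0 :> R by rewrite pnatr_eq0 -lt0n.
rewrite /S_star shuffle_copulaE ?muln_gt0//.
rewrite (sum_pairs _ (fun i => seg (1 / (2 * N)%:R) (i%:R / (2 * N)%:R) 1
   (((pi_star i.+1)%:R - 1) / (2 * N)%:R) 1 u v)).
rewrite /osum mulr_sumr; apply: eq_bigr => i _.
rewrite E_cop_scale//; last by lra.
rewrite subrr mul0r !twin0 addr0 add0r addrC /twin.
have -> : pi_star (2 * i).+1 = (2 * i).+2 by rewrite /pi_star/= oddM.
have -> : pi_star (2 * i).+2 = (2 * i).+1 by rewrite /pi_star/= oddM.
by congr (seg _ _ _ _ _ _ _ + seg _ _ _ _ _ _ _); rewrite -?natr1 !natrM; field.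
Qed.

End members.

(** * Comparison of s and r *)

Section comparison.
Variable R : realType.

(** Both functionals are affine in the two moments; keeping the moments as witnesses
    allows convex combinations of copulas to be formed. *)
Definition attained (C : R -> R -> R) (x y : R) : Prop :=
  is_copula C /\ exists d e, [/\ moments C d e, x = 6 * d - 2 & y = 12 * e - 3].

Lemma attainedP C x y : attained C x y -> [/\ is_copula C, phi C = x & rho C = y].
Proof.
move=> [CC [d [e [M -> ->]]]]; split=> //; first exact: moments_phi M.
exact: moments_rho M.
Qed.

Lemma eq_attained C D x y :
  (forall u v, 0 <= u <= 1 -> 0 <= v <= 1 -> C u v = D u v) ->
  attained C x y -> attained D x y.
Proof.
move=> CD [CC [d [e [M xE yE]]]]; split; first exact: eq_is_copula CC.
by exists d, e; split=> //; exact: eq_moments M.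
Qed.

(** Copulas form a convex set on which both functionals are affine. *)
Lemma attained_chord A B (x x1 y1 x2 y2 : R) : attained A x1 y1 -> attained B x2 y2 ->
  x1 < x2 -> x1 <= x <= x2 ->
  exists C, attained C x ((y2 - y1) / (x2 - x1) * (x - x1) + y1).
Proof.
move=> [CA [d1 [e1 [M1 x1E y1E]]]] [CB [d2 [e2 [M2 x2E y2E]]]] x12 /andP[x1x xx2].
pose t := (x - x1) / (x2 - x1).
have dx : 0 < x2 - x1 by rewrite subr_gt0.
have t0 : 0 <= t by rewrite divr_ge0//; lra.
have t1 : t <= 1 by rewrite ler_pdivrMr// mul1r; lra.
exists (fun u v => (1 - t) * A u v + t * B u v); split.
  case: CA => [A0l A0r A1l A1r A2]; case: CB => [B0l B0r B1l B1r B2].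
  split=> [v v01|u u01|v v01|u u01|u1 u2 v1 v2 *].
  - by rewrite A0l// B0l// !mulr0 addr0.
  - by rewrite A0r// B0r// !mulr0 addr0.
  - by rewrite A1l// B1l//; ring.
  - by rewrite A1r// B1r//; ring.
  - have hA : 0 <= (1 - t) * (A u2 v2 - A u2 v1 - A u1 v2 + A u1 v1).
      by apply: mulr_ge0; [lra | exact: A2].
    have hB : 0 <= t * (B u2 v2 - B u2 v1 - B u1 v2 + B u1 v1).
      by apply: mulr_ge0; [lra | exact: B2].
    by lra.
exists ((1 - t) * d1 + t * d2), ((1 - t) * e1 + t * e2); split.
- exact: momentsD (momentsZ _ M1) (momentsZ _ M2).
- have -> : 6 * ((1 - t) * d1 + t * d2) - 2 = x1 + t * (x2 - x1).
    by rewrite x1E x2E; ring.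
  by rewrite /t divfK ?gt_eqF//; ring.
- have -> : 12 * ((1 - t) * e1 + t * e2) - 3 = y1 + t * (y2 - y1).
    by rewrite y1E y2E; ring.
  by rewrite /t; ring.
Qed.

Lemma attained_osum (a : R) N : 1 / 4 <= a <= 1 / 2 -> (0 < N)%N ->
  attained (osum N (E_cop a)) (1 - 6 * (a - a ^+ 2) / N%:R)
    (1 - (6 * a - 8 * a ^+ 3 - 1 / 2) / N%:R ^+ 2).
Proof.
move=> a01 N0; have NR : N%:R != 0 :> R by rewrite pnatr_eq0 -lt0n.
split; first by apply: osum_is_copula => //; exact: E_cop_is_copula.
do 2 eexists; split; first exact: moments_osum.
  by field.
by field.
Qed.

Lemma attained_S_star N : (0 < N)%N ->
  attained (S_star (2 * N)%N) (1 - 3 / (2 * N%:R)) (1 - 3 / (2 * N%:R ^+ 2)).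
Proof.
move=> N0; have NR : N%:R != 0 :> R by rewrite pnatr_eq0 -lt0n.
have a01 : 1 / 4 <= (1 / 2 : R) <= 1 / 2 by lra.
apply: (@eq_attained (osum N (E_cop (1 / 2)))) => [u v u01 v01|].
  by rewrite S_starE.
have := attained_osum a01 N0.
set x := (X in attained _ X _ -> _); set y := (X in attained _ _ X -> _).
have -> : x = 1 - 3 / (2 * N%:R) by rewrite /x; field.
by have -> : y = 1 - 3 / (2 * N%:R ^+ 2) by rewrite /y; field.
Qed.

Lemma attained_O_star N : (0 < N)%N -> attained (O_star N)
  (1 - 3 * (N%:R + 2) / (2 * (N%:R + 1) ^+ 2))
  (1 - (3 * N%:R ^+ 3 + 9 * N%:R ^+ 2 + 3 * N%:R - 1)
       / (2 * N%:R ^+ 2 * (N%:R + 1) ^+ 3)).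
Proof.
move=> N0; have N1 : 1 <= N%:R :> R by rewrite ler1n.
have NR : N%:R != 0 :> R by rewrite pnatr_eq0 -lt0n.
have NR1 : N%:R + 1 != 0 :> R by rewrite gt_eqF//; lra.
have N2 : 0 < 2 * N%:R + 2 :> R by lra.
have a01 : 1 / 4 <= a_seq R N <= 1 / 2.
  by rewrite /a_seq ler_pdivlMr// ler_pdivrMr//; lra.
apply: (@eq_attained (osum N (E_cop (a_seq R N)))) => [u v u01 v01|].
  by rewrite /O_star O_copE.
have := attained_osum a01 N0.
set x := (X in attained _ X _ -> _); set y := (X in attained _ _ X -> _).
have -> : x = 1 - 3 * (N%:R + 2) / (2 * (N%:R + 1) ^+ 2).
  by rewrite /x /a_seq; field; rewrite NR NR1 gt_eqF.
have -> // : y = 1 - (3 * N%:R ^+ 3 + 9 * N%:R ^+ 2 + 3 * N%:R - 1)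
       / (2 * N%:R ^+ 2 * (N%:R + 1) ^+ 3).
by rewrite /y /a_seq; field; rewrite NR NR1 gt_eqF.
Qed.

(** The affine function that r follows between the points 1 - 3/(2N) and
    1 - 3/(2(N + 1)). *)
Definition r_line (N : nat) (x : R) : R :=
  (2 * N%:R + 1) / (N%:R ^+ 2 + N%:R) * x
  + (2 * N%:R ^+ 2 - 2 * N%:R + 1) / (2 * N%:R ^+ 2 + 2 * N%:R).

(** In this form the gap between s and r is read off from the gaps at the two
    vertices of an edge of s. *)
Lemma r_line_chord N (x x1 y1 x2 y2 : R) : x1 < x2 ->
  (y2 - y1) / (x2 - x1) * (x - x1) + y1 - r_line N x =
  (y1 - r_line N x1) * ((x2 - x) / (x2 - x1)) + (y2 - r_line N x2) * ((x - x1) / (x2 - x1)).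
Proof.
move=> x12; pose p : R := (2 * N%:R + 1) / (N%:R ^+ 2 + N%:R).
pose q : R := (2 * N%:R ^+ 2 - 2 * N%:R + 1) / (2 * N%:R ^+ 2 + 2 * N%:R).
have rE z : r_line N z = p * z + q by [].
by rewrite !rE; field; rewrite subr_eq0 gt_eqF.
Qed.

Lemma r_line_lknot N : (0 < N)%N ->
  1 - 3 / (2 * N%:R ^+ 2) = r_line N (1 - 3 / (2 * N%:R)).
Proof.
move=> N0; have N1 : 1 <= N%:R :> R by rewrite ler1n.
have N2 := sqr_ge0 (N%:R : R).
by rewrite /r_line; field; apply/and3P; split; rewrite gt_eqF//; lra.
Qed.

Lemma r_line_rknot N : (0 < N)%N ->
  1 - 3 / (2 * (N%:R + 1) ^+ 2) = r_line N (1 - 3 / (2 * (N%:R + 1))).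
Proof.
move=> N0; have N1 : 1 <= N%:R :> R by rewrite ler1n.
have N2 := sqr_ge0 (N%:R : R).
by rewrite /r_line; field; apply/and3P; split; rewrite gt_eqF//; lra.
Qed.

(** The gain of the intermediate copula O over the chord of the shuffles. *)
Lemma O_star_above_r_line N : (0 < N)%N ->
  (1 - (3 * N%:R ^+ 3 + 9 * N%:R ^+ 2 + 3 * N%:R - 1)
       / (2 * N%:R ^+ 2 * (N%:R + 1) ^+ 3))
  - r_line N (1 - 3 * (N%:R + 2) / (2 * (N%:R + 1) ^+ 2)) =
  1 / (2 * N%:R ^+ 2 * (N%:R + 1) ^+ 3).
Proof.
move=> N0; have N1 : 1 <= N%:R :> R by rewrite ler1n.
have N2 := sqr_ge0 (N%:R : R).
by rewrite /r_line; field; apply/and4P; split; rewrite gt_eqF//; lra.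
Qed.

(** The increasing coordinate y = 3 / (2 (1 - x)) sends the points 1 - 3/(2N) to the
    integers N. *)
Lemma knot_coordinate (x : R) : x < 1 -> exists2 y, 0 < y & forall c, 0 < c ->
  ((1 - 3 / (2 * c) <= x) = (c <= y)) * ((x <= 1 - 3 / (2 * c)) = (y <= c)) *
  ((x == 1 - 3 / (2 * c)) = (y == c)).
Proof.
move=> x1; exists (3 / (2 * (1 - x))); first by apply: divr_gt0; lra.
have x0 : 0 < 2 * (1 - x) by lra.
have lt c : 0 < c -> (1 - 3 / (2 * c) <= x) = (c <= 3 / (2 * (1 - x))).
  move=> c0; have c2 : 0 < 2 * c by lra.
  rewrite ler_pdivlMr// lerBlDr addrC -lerBlDr ler_pdivlMr//.
  by rewrite (_ : (1 - x) * (2 * c) = c * (2 * (1 - x)))//; ring.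
have gt c : 0 < c -> (x <= 1 - 3 / (2 * c)) = (3 / (2 * (1 - x)) <= c).
  move=> c0; have c2 : 0 < 2 * c by lra.
  rewrite ler_pdivrMr// lerBrDr addrC -lerBrDr ler_pdivrMr//.
  by rewrite (_ : (1 - x) * (2 * c) = c * (2 * (1 - x)))//; ring.
by move=> c c0; rewrite lt// gt// !eq_le lt// gt//.
Qed.

(** One of the two chords ends at the shuffle on the left and the other one at the
    shuffle on the right, where the gap to r vanishes; both end at O, where it is
    positive. Hence the gap is positive away from the shuffles. *)
Lemma attained_upper_branch N (x y : R) : (2 <= N)%N ->
  x != 1 - 3 / (2 * N%:R) -> x != 1 - 3 / (2 * (N%:R + 1)) ->
  let S1 := @S_star R (2 * N)%N in let S2 := @S_star R (2 * N + 2)%N in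
  let O := @O_star R N in
  (phi S1 <= x <= phi O /\ y = (rho O - rho S1) / (phi O - phi S1) * (x - phi S1) + rho S1) \/
  (phi O <= x <= phi S2 /\ y = (rho S2 - rho O) / (phi S2 - phi O) * (x - phi O) + rho O) ->
  [/\ 1 - 3 / (2 * N%:R) <= x <= 1 - 3 / (2 * (N%:R + 1)), r_line N x < y
     & exists C, attained C x y].
Proof.
move=> N2 xl xr S1 S2 O; have N0 : (0 < N)%N by exact: ltn_trans N2.
have N1 : 1 <= N%:R :> R by rewrite ler1n.
have gap0 : 0 < 1 / (2 * N%:R ^+ 2 * (N%:R + 1) ^+ 3) :> R.
  by rewrite divr_gt0// mulr_gt0 ?exprn_gt0 ?mulr_gt0 ?exprn_gt0//; lra.
have nN : N%:R != 0 :> R by rewrite gt_eqF//; lra.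
have nN1 : N%:R + 1 != 0 :> R by rewrite gt_eqF//; lra.
have o1 : 1 - 3 / (2 * N%:R) < 1 - 3 * (N%:R + 2) / (2 * (N%:R + 1) ^+ 2) :> R.
  rewrite -subr_gt0.
  rewrite (_ : _ - _ = 3 / (2 * N%:R * (N%:R + 1) ^+ 2)); last by field; rewrite nN nN1.
  by rewrite divr_gt0// mulr_gt0 ?exprn_gt0//; lra.
have o2 : 1 - 3 * (N%:R + 2) / (2 * (N%:R + 1) ^+ 2) < 1 - 3 / (2 * (N%:R + 1)) :> R.
  rewrite -subr_gt0.
  rewrite (_ : _ - _ = 3 / (2 * (N%:R + 1) ^+ 2)); last by field; rewrite nN1.
  by rewrite divr_gt0// mulr_gt0 ?exprn_gt0//; lra.
have A1 := attained_S_star N0; have A2 := attained_S_star (ltn0Sn N).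
have AO := attained_O_star N0.
have eN : (2 * N.+1 = 2 * N + 2)%N by rewrite mulnS addnC.
rewrite eN -(natr1 N) in A2.
have [_ phi1 rho1] := attainedP A1; have [_ phi2 rho2] := attainedP A2.
have [_ phiO rhoO] := attainedP AO.
have gap := O_star_above_r_line N0; have e1 := r_line_lknot N0; have e2 := r_line_rknot N0.
move: phi1 rho1 phi2 rho2 phiO rhoO; rewrite -/S1 -/S2 -/O => -> -> -> -> -> ->.
move=> [[/andP[xa xb] ->]|[/andP[xa xb] ->]]; split.
- by lra.
- rewrite -subr_gt0 r_line_chord// e1 subrr mul0r add0r gap mulr_gt0//.
  by rewrite divr_gt0 ?subr_gt0// lt_neqAle eq_sym xl.
- by apply: attained_chord A1 AO _ _ => //; rewrite xa.
- by lra.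
- rewrite -subr_gt0 r_line_chord// e2 subrr mul0r addr0 gap mulr_gt0//.
  by rewrite divr_gt0 ?subr_gt0// lt_neqAle xr.
- by apply: attained_chord AO A2 _ _ => //; rewrite xa.
Qed.

(** With T = sqrt (1 - 4x), the gap to the line is T^2 (3 - sqrt 6 T) / 36, positive
    for x > -1/8. The copula is [bridge c] for the c such that x = 1/4 - 6 c^2. *)
Lemma attained_lower_branch (x : R) : - (1 / 8) < x < 1 / 4 ->
  let y := x + 3 / 8 - Num.sqrt 6 / 36 * (1 - 4 * x) `^ (3 / 2) in
  4 / 3 * x + 7 / 24 < y /\ exists C, attained C x y.
Proof.
move=> /andP[x0 x1]; have X0 : 0 <= 1 - 4 * x by lra.
pose T := Num.sqrt (1 - 4 * x); pose g : R := Num.sqrt 6.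
have T2 : T ^+ 2 = 1 - 4 * x by rewrite sqr_sqrtr.
have g2 : g ^+ 2 = 6 by rewrite sqr_sqrtr//; lra.
have T0 : 0 < T by rewrite sqrtr_gt0; lra.
have g0 : 0 < g by rewrite sqrtr_gt0; lra.
have TE : (1 - 4 * x) `^ (3 / 2) = T ^+ 3.
  by rewrite (_ : 3 / 2 = 2^-1 * 3%:R) ?powRrM ?powR12_sqrt ?powR_mulrn ?sqrtr_ge0//; ring.
clearbody T; have gT : g * T < 3.
  have gT0 : 0 <= g * T by rewrite mulr_ge0 ?ltW.
  rewrite -(@ltr_pXn2r _ 2)// ?nnegrE//; first by rewrite exprMn g2 T2; lra.
rewrite /= TE -/g; split.
  have xE : x = (1 - T ^+ 2) / 4 by rewrite T2; field.
  rewrite -subr_gt0 (_ : _ - _ = T ^+ 2 / 36 * (3 - g * T)); last by rewrite xE; field.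
  by rewrite mulr_gt0 ?divr_gt0 ?exprn_gt0 ?subr_gt0.
pose c := T / (2 * g).
have g20 : 0 < 2 * g by lra.
have c0 : 0 <= c by rewrite divr_ge0 ?ltW.
have c2 : c ^+ 2 = (1 - 4 * x) / 24.
  by rewrite /c expr_div_n exprMn g2 T2; field.
have c3 : 8 * c ^+ 3 = g / 36 * T ^+ 3.
  have gE : g / 36 = (6 * g)^-1.
    by rewrite (_ : 36 = 6 * g ^+ 2); [field; rewrite gt_eqF | rewrite g2; ring].
  rewrite gE /c expr_div_n exprMn [g ^+ 3]exprS g2.
  by field; rewrite gt_eqF.
have c01 : 0 <= c <= 1 / 4.
  have q0 : 0 <= 1 / 4 :> R by lra.
  by rewrite c0/= -(@ler_pXn2r _ 2)// c2; lra.
exists (bridge c); split; first exact: bridge_is_copula.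
do 2 eexists; split; first exact: moments_bridge.
- by rewrite c2; lra.
- by rewrite -c3 c2; lra.
Qed.

End comparison.

Unset Implicit Arguments.

Theorem theorem5p3 (R : realType) (x : R)
  (hx : - (1 / 8) < x < 1)
  (hxN : ~ exists N : nat, (2 <= N)%N /\ x = 1 - 3 / (2 * N%:R)) :
  r_fun x < s_fun x /\
  exists C : R -> R -> R, is_copula C /\ phi C = x /\ rho C = s_fun x.
Proof.
have /andP[x0 x1] := hx.
have [y y0 yE] := knot_coordinate x1.
have le_y N : (0 < N)%N -> (N%:R <= y) = (1 - 3 / (2 * N%:R) <= x).
  by move=> N0; rewrite yE// ltr0n.
have y_le N : (0 < N)%N -> (y <= N%:R) = (x <= 1 - 3 / (2 * N%:R)).
  by move=> N0; rewrite yE// ltr0n.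
have y_eq N : (0 < N)%N -> (y == N%:R) = (x == 1 - 3 / (2 * N%:R)).
  by move=> N0; rewrite yE// ltr0n.
have knot N : (2 <= N)%N -> x != 1 - 3 / (2 * N%:R).
  by move=> N2; apply/eqP => xN; apply: hxN; exists N.
have knot1 N : (2 <= N)%N -> x != 1 - 3 / (2 * (N%:R + 1)).
  by move=> N2; rewrite natr1; apply: knot; exact: leqW.
have quarter : 1 - 3 / (2 * 2%:R) = 1 / 4 :> R by lra.
(* x lies strictly between two consecutive knots, hence the branches selected by
   r and by s have the same index. *)
have between N : (2 <= N)%N ->
    1 - 3 / (2 * N%:R) <= x <= 1 - 3 / (2 * (N%:R + 1)) -> N%:R < y < N%:R + 1.
  move=> N2; have N1 : 1 <= N%:R :> R by rewrite ler1n (leq_trans _ N2).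
  have N0 : 0 < N%:R :> R by lra.
  have N10 : 0 < N%:R + 1 :> R by lra.
  have := knot N N2; have := knot1 N N2; rewrite !yE// => yr yl /andP[ly ry].
  by rewrite !lt_neqAle ly ry yr eq_sym yl.
have cover : - (1 / 8) <= x <= 1 / 4 \/ exists2 N, (2 <= N)%N &
    1 - 3 / (2 * N%:R) <= x <= 1 - 3 / (2 * (N%:R + 1)).
  have [xq|qx] := leP x (1 / 4); [by left; lra | right].
  have y2 : 2 <= y by rewrite le_y// quarter ltW.
  have /andP[Ny yN] := truncn_itv (ltW y0).
  have N2 : (2 <= Num.trunc y)%N by rewrite -ltnS -(ltr_nat R); apply: le_lt_trans yN.
  exists (Num.trunc y) => //; have N1 : 1 <= (Num.trunc y)%:R :> R by rewrite ler1n (leq_trans _ N2).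
  by rewrite !yE ?natr1 ?Ny ?(ltW yN)//; lra.
have r_lt z : (forall w, r_graph x w -> w < z) -> r_fun x < z.
  apply; rewrite /r_fun; apply: (@xgetPex _ (0 : R) [set w | r_graph x w]).
  case: cover => [h|[N N2 h]]; [eexists; exact: r_piece2 h | eexists; exact: r_piece3 N2 h].
have : s_graph x (s_fun x).
  rewrite /s_fun; apply: (@xgetPex _ (0 : R) [set w | s_graph x w]).
  case: cover => [h|[N N2 /andP[xl xr]]]; first by eexists; exact: s_piece2 h.
  have N0 : (0 < N)%N by exact: ltn_trans N2.
  have [_ phi1 _] := attainedP (attained_S_star R N0).
  have [_ phi2 _] := attainedP (attained_S_star R (ltn0Sn N)).
  have eN : (2 * N.+1 = 2 * N + 2)%N by rewrite mulnS addnC.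
  rewrite eN -(natr1 N) in phi2.
  have [xO|Ox] := leP x (phi (@O_star R N)).
    by eexists; apply: s_piece3 N2 _; rewrite phi1 xl.
  by eexists; apply: s_piece4 N2 _; rewrite phi2 xr (ltW Ox).
have x_knot2 := knot 2%N isT; rewrite quarter in x_knot2.
have lower z : - (1 / 8) <= x <= 1 / 4 ->
    z = x + 3 / 8 - Num.sqrt 6 / 36 * (1 - 4 * x) `^ (3 / 2) ->
    r_fun x < z /\ exists C, is_copula C /\ phi C = x /\ rho C = z.
  move=> /andP[_ xq] ->.
  have xq' : x < 1 / 4 by rewrite lt_neqAle x_knot2.
  have xlow : - (1 / 8) < x < 1 / 4 by rewrite x0.
  have [rs [C CA]] := attained_lower_branch xlow.
  split; last by exists C; have [? ? ?] := attainedP CA.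
  apply: r_lt => w [h|h|N N2 /andP[h _]|h] //; [lra | exfalso | lra].
  have N2R : 2 <= N%:R :> R by rewrite ler_nat.
  have : N%:R <= y by rewrite le_y ?(ltn_trans _ N2)//; lra.
  have : y <= 2 by rewrite y_le// quarter.
  have : y != 2 by rewrite y_eq// quarter.
  by rewrite neq_lt => /orP[]; lra.
have upper N z : (2 <= N)%N ->
    1 - 3 / (2 * N%:R) <= x <= 1 - 3 / (2 * (N%:R + 1)) -> r_line N x < z ->
    (exists C, attained C x z) ->
    r_fun x < z /\ exists C, is_copula C /\ phi C = x /\ rho C = z.
  move=> N2 xN rz [C CA]; split; last by exists C; have [? ? ?] := attainedP CA.
  have N2R : 2 <= N%:R :> R by rewrite ler_nat.
  have /andP[Ny yN] := between N N2 xN.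
  apply: r_lt => w [h|/andP[_ h]|n n2 h|h]; [lra | exfalso | | lra].
    have : y <= 2 by rewrite y_le// quarter.
    lra.
  have /andP[ny yn] := between n n2 h.
  suff -> : n = N by [].
  have nN : (n < N.+1)%N by rewrite -(ltr_nat R) -natr1; lra.
  have Nn : (N < n.+1)%N by rewrite -(ltr_nat R) -natr1; lra.
  by apply/eqP; rewrite eqn_leq -ltnS nN -ltnS Nn.
move: (s_fun x) => z [h|h|N N2 h|N N2 h|h]; [lra | exact: lower | | | lra].
- have [xN rz CA] := @attained_upper_branch R N x _ N2 (knot N N2) (knot1 N N2)
    (or_introl (conj h erefl)).
  exact: upper xN rz CA.
- have [xN rz CA] := @attained_upper_branch R N x _ N2 (knot N N2) (knot1 N N2)
    (or_intror (conj h erefl)).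
  exact: upper xN rz CA.
Qed.
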